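(* Let $r\ge1$ be an integer. Choose an element $g\in W$ and an eigenvector $A\in\mathfrak t(g,\zeta_r)$; let $\phi=\phi_A=\{\alpha\in\Phi:\alpha(A)=0\}$ be the Levi annihilator of $A$. If Howlett's twist $\widetilde W(\phi)=W(\phi)/W'(\phi)$ is trivial, then the centralizer $Z_{W,\phi}(g)=Z_{W(\phi)}(g_\phi)\subset W(\phi)$ acts faithfully on $\mathfrak t_\phi(g_\phi,\zeta_r)$ as a complex reflection group.
   Context: $G$ is a connected complex reductive algebraic group with maximal torus $T$, Lie algebras $\mathfrak t\subset\mathfrak g$, root system $\Phi\subset\mathfrak t^\vee$, Weyl group $W$ acting on $\mathfrak t$; $\zeta_r=e^{2\pi\sqrt{-1}/r}$; for a linear automorphism $g$ of $V$, $V(g,\zeta)=\ker(g-\zeta\,\mathrm{Id}_V)$. $\mathfrak t_\phi=\bigcap_{\alpha\in\phi}\ker\alpha\subset\mathfrak t$; $N_W(\mathfrak t_\phi)$ and $W_{\mathfrak t_\phi}$ are the setwise and pointwise stabilizers of $\mathfrak t_\phi$ in $W$; $W(\phi)=N_W(\mathfrak t_\phi)/W_{\mathfrak t_\phi}$, which acts faithfully on $\mathfrak t_\phi$. Under the hypotheses $g\in N_W(\mathfrak t_\phi)$, and $g_\phi$ denotes its restriction to $\mathfrak t_\phi$, equivalently its class in $W(\phi)$. Fix a $W$-invariant Hermitian inner product on $\mathfrak t$. For $\alpha\in\Phi\setminus\phi$ let $\sigma_\alpha(\phi)\in GL(\mathfrak t_\phi)$ be the order-2 orthogonal reflection about the hyperplane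 $\ker(\alpha)\cap\mathfrak t_\phi$ of $\mathfrak t_\phi$. Howlett's relative reflection group $W'(\phi)\subset W(\phi)$ is the (normal) subgroup generated by the elements of $W(\phi)$ which act on $\mathfrak t_\phi$ as one of the reflections $\sigma_\alpha(\phi)$, $\alpha\in\Phi\setminus\phi$; Howlett's twist is the quotient $\widetilde W(\phi)=W(\phi)/W'(\phi)$. A complex reflection group is a finite subgroup of $GL(V)$ generated by elements whose fixed space is a hyperplane. *)

(* Defs.v *)
From HB Require Import structures.
From mathcomp Require Import all_boot all_order all_algebra all_fingroup.
From mathcomp Require Import all_solvable all_character.
From mathcomp Require Import complex.
From mathcomp Require Import boolp reals trigo.

Set Implicit Arguments.
Unset Strict Implicit.
Unset Printing Implicit Defensive.

Import Order.TTheory GRing.Theory Num.Theory.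
Local Open Scope group_scope.
Local Open Scope ring_scope.

(* A connected complex reductive group with a maximal torus is encoded by its
   root datum.  The cocharacter lattice is Z^n (row vectors), the character
   lattice is its dual Z^n (column vectors), paired by the matrix product, and
   the finite set of roots is listed without repetition by 'I_N.  The roots
   need not span, since the group need not be semisimple. *)
Record rootDatum (n N : nat) := RootDatum {
  rd_root : 'I_N -> 'cV[int]_n;
  rd_coroot : 'I_N -> 'rV[int]_n;
  rd_root_inj : injective rd_root;
  rd_coroot_inj : injective rd_coroot;
  rd_root_coroot2 : forall i, rd_coroot i *m rd_root i = 2%:M;
  rd_root_refl : forall i j, exists k,
    rd_root k = rd_root j - rd_root i *m (rd_coroot i *m rd_root j);
  rd_coroot_refl : forall i j, exists k,
    rd_coroot k = rd_coroot j - rd_coroot j *m rd_root i *m rd_coroot i;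
  rd_root_reduced : forall i j (c : int),
    rd_root i = c *: rd_root j -> c = 1 \/ c = -1
}.

Definition zeta (R : realType) (r : nat) : R[i] :=
  Complex (cos (2 * pi / r%:R)) (sin (2 * pi / r%:R)).

Section WeylGroup.
Variables (C : fieldType) (n N : nat) (D : rootDatum n N).

(* The Cartan subalgebra t is 'rV[C]_n; root i is the linear form
   v |-> v *m root_form i. *)
Definition root_form (i : 'I_N) : 'cV[C]_n := map_mx intr (rd_root D i).
Definition coroot_vec (i : 'I_N) : 'rV[C]_n := map_mx intr (rd_coroot D i).

(* v *m root_reflection i = v - alpha_i(v) alpha_i^vee *)
Definition root_reflection (i : 'I_N) : 'M[C]_n :=
  1%:M - root_form i *m coroot_vec i.

(* W, acting on t through rW, is the subgroup of GL(t) generated by the root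
   reflections.  Matrices act on the right of row vectors, so the product of W
   is composition in diagrammatic order. *)
Record is_weyl_group (gT : finGroupType) (W : {group gT})
    (rW : mx_representation C W n) : Prop := IsWeylGroup {
  weyl_faithful : mx_faithful rW;
  weyl_reflection : forall i, exists2 w, w \in W & rW w = root_reflection i;
  weyl_generated :
    <<[set w in W | [exists i, rW w == root_reflection i]]>>%g = W
}.

Definition levi_annihilator (A : 'rV[C]_n) : {set 'I_N} :=
  [set i | A *m root_form i == 0].

(* t_phi, as a row space; it is all of t when phi is empty *)
Definition levi_space (phi : {set 'I_N}) : 'M[C]_n :=
  (\bigcap_(i in phi) kermx (root_form i))%MS.

End WeylGroup.

Section StabilizerQuotient.
Variables (C : fieldType) (n : nat) (gT : finGroupType) (W : {group gT}).
Variables (rW : mx_representation C W n) (U : 'M[C]_n).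

Lemma rstabs_mxmodule : mxmodule (subg_repr rW (rstabs_sub rW U)) U.
Proof. by rewrite /mxmodule rstabs_subg setIid. Qed.

Definition rstabs_repr := submod_repr rstabs_mxmodule.

Lemma rstab_rker : rstab rW U \subset rker rstabs_repr.
Proof.
rewrite rker_submod rstab_subg subsetI subxx andbT.
by apply/subsetP=> x /setIdP[Wx /eqP Ux]; rewrite inE Wx Ux submx_refl.
Qed.

Lemma rstabs_norm_rstab : rstabs rW U \subset 'N(rstab rW U).
Proof.
have -> : rstab rW U = rker rstabs_repr; last exact: rker_norm.
apply/eqP; rewrite eqEsubset rstab_rker /=.
by rewrite rker_submod rstab_subg subsetIr.
Qed.

(* N_W(U) / W_U: setwise modulo pointwise stabilizer *)
Definition rel_weyl : {set coset_of (rstab rW U)} :=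
  (rstabs rW U / rstab rW U)%g.
Canonical rel_weyl_group := Eval hnf in [group of rel_weyl].

(* The action of N_W(U) / W_U on U, in the coordinates of val_submod. *)
Definition rel_weyl_repr : mx_representation C rel_weyl (\rank U) :=
  quo_repr rstab_rker rstabs_norm_rstab.

End StabilizerQuotient.

Section Howlett.
Variables (C : numClosedFieldType) (n N : nat) (D : rootDatum n N).
Variables (gT : finGroupType) (W : {group gT}).
Variables (rW : mx_representation C W n).
Variables (h : {dot 'rV[C]_n for Num.conj}) (phi : {set 'I_N}).

Definition W_invariant : Prop :=
  forall w, w \in W -> forall u v, h (u *m rW w) (v *m rW w) = h u v.

Local Notation U := (levi_space C D phi).

(* f is the h-orthogonal reflection of t_phi about ker(alpha_i) in t_phi, i.e.
   1 on that hyperplane and -1 on its orthogonal complement in t_phi. *)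
Definition is_sigma (i : 'I_N) (f : 'M[C]_(\rank U)) : Prop :=
  (forall v : 'rV_(\rank U),
     val_submod v *m root_form C D i = 0 -> v *m f = v) /\
  (forall v : 'rV_(\rank U),
     (forall u : 'rV_(\rank U), val_submod u *m root_form C D i = 0 ->
        h (val_submod v) (val_submod u) = 0) ->
     v *m f = - v).

Definition levi_weyl : {set coset_of (rstab rW U)} := rel_weyl rW U.
Canonical levi_weyl_group := Eval hnf in [group of levi_weyl].

Definition levi_weyl_repr : mx_representation C levi_weyl (\rank U) :=
  rel_weyl_repr rW U.

Definition howlett_group : {set coset_of (rstab rW U)} :=
  <<[set x in levi_weyl |
      `[< exists2 i, i \notin phi & is_sigma i (levi_weyl_repr x) >]]>>%g.
Canonical howlett_group_group := Eval hnf in [group of howlett_group].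

Definition howlett_twist : {set coset_of howlett_group} :=
  (levi_weyl / howlett_group)%g.

End Howlett.

(* For a faithful rG: G acts as a complex reflection group; it is finite since
   gT is. *)
Definition is_reflection_group_repr (C : fieldType) (n : nat)
    (gT : finGroupType) (G : {group gT}) (rG : mx_representation C G n) : Prop :=
  <<[set x in G | (\rank (rfix_mx rG [set x])).+1 == n]>>%g = G.

(* Main.v *)
Require Import Defs.
From HB Require Import structures.
From mathcomp Require Import all_boot all_order all_algebra all_fingroup.
From mathcomp Require Import all_solvable all_character.
From mathcomp Require Import complex.
From mathcomp Require Import boolp reals trigo.
From mathcomp Require Import ring zify mpoly.

Set Implicit Arguments.
Unset Strict Implicit.
Unset Printing Implicit Defensive.

Import Order.TTheory GRing.Theory Num.Theory.
Local Open Scope ring_scope.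

(** Triviality of the twist means that W(phi) is generated by the reflections
    sigma_alpha, none of whose hyperplanes contains the eigenvector A: so A is
    a regular vector of a reflection group G acting on V = t_phi, and the
    statement is Springer's theorem on centralisers of regular elements.

    By Chevalley, C[V]^G is generated by algebraically independent homogeneous
    invariants f_1, ..., f_n.  Separating the points of an orbit by invariants
    shows that their Jacobian does not vanish at vectors with trivial
    stabiliser.  Removing from the Jacobian its factors along the reflecting
    hyperplanes leaves a constant, since a nonconstant homogeneous polynomial
    has zeros on a generic plane; hence A, which lies on no reflecting
    hyperplane, has trivial stabiliser (a case of Steinberg's theorem), which
    gives faithfulness.

    On E = V(g, zeta) the f_i with zeta^(d_i) <> 1 vanish, and the Jacobian at A
    shows that the others restrict to dim E algebraically independent
    polynomials.  Their algebra is the whole of C[E]^Z, where Z centralises g: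
    it contains D u for every u in C[E]^Z and a fixed D <> 0, so D^k divides
    (D u)^(k+1) for all k, and D divides D u.

    A group Z with polynomial invariants F is generated by reflections: if H is
    the subgroup generated by the reflections and e are basic invariants of H,
    then F = P(e), and the Jacobian of P is invertible at e(v) as soon as the
    stabiliser of v lies in H, hence outside a set of codimension at least two.
    It is thus a nonzero constant, so e is a polynomial in F and H = Z. *)

(** * Polynomials as functions *)

HB.lock Definition pcomp (C : comNzRingType) k n (f : 'I_k -> {mpoly C[n]})
    (p : {mpoly C[k]}) : {mpoly C[n]} := mmap (@mpolyC n C) f p.

HB.lock Definition ev (C : comNzRingType) n (v : 'rV[C]_n)
    (p : {mpoly C[n]}) : C := meval (fun i => v 0 i) p.

Definition linp (C : nzRingType) n (l : 'cV[C]_n) : {mpoly C[n]} :=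
  \sum_j l j 0 *: 'X_j.

(** Pullback of functions along [v |-> v *m M], see [ev_act]. Rectangular [M] are allowed because
    restriction to a subspace is the pullback along a row basis. *)
HB.lock Definition act (C : comNzRingType) m n (M : 'M[C]_(m, n))
    (p : {mpoly C[n]}) : {mpoly C[m]} := pcomp (fun i => linp (col i M)) p.

Section Evaluation.
Variable C : comNzRingType.

Lemma pcomp_zmod k n (f : 'I_k -> {mpoly C[n]}) : zmod_morphism (pcomp f).
Proof. by move=> p q; rewrite pcomp.unlock; exact: rmorphB. Qed.

Lemma pcomp_monoid k n (f : 'I_k -> {mpoly C[n]}) : monoid_morphism (pcomp f).
Proof. by split=> [|p q]; rewrite pcomp.unlock; [exact: rmorph1|exact: rmorphM]. Qed.

HB.instance Definition _ k n (f : 'I_k -> {mpoly C[n]}) :=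
  GRing.isZmodMorphism.Build _ _ (pcomp f) (pcomp_zmod f).
HB.instance Definition _ k n (f : 'I_k -> {mpoly C[n]}) :=
  GRing.isMonoidMorphism.Build _ _ (pcomp f) (pcomp_monoid f).

Lemma ev_zmod n (v : 'rV[C]_n) : zmod_morphism (ev v).
Proof. by move=> p q; rewrite ev.unlock; exact: rmorphB. Qed.

Lemma ev_monoid n (v : 'rV[C]_n) : monoid_morphism (ev v).
Proof. by split=> [|p q]; rewrite ev.unlock; [exact: rmorph1|exact: rmorphM]. Qed.

HB.instance Definition _ n (v : 'rV[C]_n) :=
  GRing.isZmodMorphism.Build _ _ (ev v) (ev_zmod v).
HB.instance Definition _ n (v : 'rV[C]_n) :=
  GRing.isMonoidMorphism.Build _ _ (ev v) (ev_monoid v).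

Lemma act_zmod m n (M : 'M[C]_(m, n)) : zmod_morphism (act M).
Proof. by move=> p q; rewrite act.unlock; exact: rmorphB. Qed.

Lemma act_monoid m n (M : 'M[C]_(m, n)) : monoid_morphism (act M).
Proof. by split=> [|p q]; rewrite act.unlock; [exact: rmorph1|exact: rmorphM]. Qed.

HB.instance Definition _ m n (M : 'M[C]_(m, n)) :=
  GRing.isZmodMorphism.Build _ _ (act M) (act_zmod M).
HB.instance Definition _ m n (M : 'M[C]_(m, n)) :=
  GRing.isMonoidMorphism.Build _ _ (act M) (act_monoid M).

(** Reduces identities compatible with sums and products to constants and variables. *)
Lemma mpoly_alg_ind n (P : {mpoly C[n]} -> Prop) :
    (forall c, P c%:MP) -> (forall i, P 'X_i) ->
    (forall p q, P p -> P q -> P (p + q)) ->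
    (forall p q, P p -> P q -> P (p * q)) -> forall p, P p.
Proof.
move=> PC PX PD PM; elim/mpolyind => [|c m p _ _ Pp]; first exact: (PC 0).
apply: (PD) => //; rewrite -mul_mpolyC; apply: (PM) => //.
rewrite mpolyXE_id; apply: (big_ind P) => [||i _]; [exact: (PC 1) | exact: PM |].
elim: (m i) => [|k IH]; first exact: (PC 1).
by rewrite exprS; apply: (PM).
Qed.

Lemma pcompC k n (f : 'I_k -> {mpoly C[n]}) c : pcomp f c%:MP = c%:MP.
Proof. by rewrite pcomp.unlock mmapC. Qed.

Lemma pcompX k n (f : 'I_k -> {mpoly C[n]}) i : pcomp f 'X_i = f i.
Proof. by rewrite pcomp.unlock mmapX mmap1U. Qed.

Lemma pcompZ k n (f : 'I_k -> {mpoly C[n]}) c p :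
  pcomp f (c *: p) = c *: pcomp f p.
Proof. by rewrite -mul_mpolyC rmorphM /= pcompC mul_mpolyC. Qed.

Lemma evC n (v : 'rV[C]_n) c : ev v c%:MP = c.
Proof. by rewrite ev.unlock; exact: mevalC. Qed.

Lemma evX n (v : 'rV[C]_n) i : ev v 'X_i = v 0 i.
Proof. by rewrite ev.unlock; exact: mevalXU. Qed.

Lemma evZ n (v : 'rV[C]_n) c p : ev v (c *: p) = c * ev v p.
Proof. by rewrite ev.unlock; exact: mevalZ. Qed.

Lemma ev_pcomp k n (f : 'I_k -> {mpoly C[n]}) v p :
  ev v (pcomp f p) = ev (\row_i ev v (f i)) p.
Proof.
elim/mpoly_alg_ind: p => [c|i|p q IHp IHq|p q IHp IHq].
- by rewrite pcompC !evC.
- by rewrite pcompX evX mxE.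
- by rewrite !rmorphD /= IHp IHq.
- by rewrite !rmorphM /= IHp IHq.
Qed.

Lemma pcomp_pcomp k l n (f : 'I_k -> {mpoly C[l]}) (g : 'I_l -> {mpoly C[n]}) p :
  pcomp g (pcomp f p) = pcomp (fun i => pcomp g (f i)) p.
Proof.
elim/mpoly_alg_ind: p => [c|i|p q IHp IHq|p q IHp IHq].
- by rewrite !pcompC.
- by rewrite !pcompX.
- by rewrite !rmorphD /= IHp IHq.
- by rewrite !rmorphM /= IHp IHq.
Qed.

Lemma eq_pcomp k n (f g : 'I_k -> {mpoly C[n]}) p :
  f =1 g -> pcomp f p = pcomp g p.
Proof.
move=> fg; elim/mpoly_alg_ind: p => [c|i|p q IHp IHq|p q IHp IHq].
- by rewrite !pcompC.
- by rewrite !pcompX.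
- by rewrite !rmorphD /= IHp IHq.
- by rewrite !rmorphM /= IHp IHq.
Qed.

Lemma pcomp_id n (p : {mpoly C[n]}) : pcomp (fun i => 'X_i) p = p.
Proof.
elim/mpoly_alg_ind: p => [c|i|p q IHp IHq|p q IHp IHq].
- by rewrite pcompC.
- by rewrite pcompX.
- by rewrite rmorphD /= IHp IHq.
- by rewrite rmorphM /= IHp IHq.
Qed.

Lemma ev_linp n (l : 'cV[C]_n) v : ev v (linp l) = (v *m l) 0 0.
Proof.
rewrite /linp raddf_sum mxE; apply: eq_bigr => j _.
by rewrite /= evZ evX mulrC.
Qed.

Lemma actC m n (M : 'M[C]_(m, n)) c : act M c%:MP = c%:MP.
Proof. by rewrite act.unlock pcompC. Qed.

Lemma actX m n (M : 'M[C]_(m, n)) i : act M 'X_i = linp (col i M).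
Proof. by rewrite act.unlock pcompX. Qed.

Lemma actZ m n (M : 'M[C]_(m, n)) c p : act M (c *: p) = c *: act M p.
Proof. by rewrite act.unlock pcompZ. Qed.

Lemma ev_act m n (M : 'M[C]_(m, n)) v p : ev v (act M p) = ev (v *m M) p.
Proof.
rewrite act.unlock ev_pcomp; congr (ev _ _); apply/rowP => i.
by rewrite !mxE ev_linp mxE; apply: eq_bigr => j _; rewrite mxE.
Qed.

Lemma mnm_neq0 n (m : 'X_{1..n}) : m != 0%MM -> exists i, m i != 0%N.
Proof.
move=> m0; apply/existsP; apply: contraNT m0; rewrite negb_exists => /forallP mi0.
by apply/eqP/mnmP => i; rewrite mnm0E; apply/eqP; have := mi0 i; rewrite negbK.
Qed.

Lemma ev0E n (p : {mpoly C[n]}) : ev 0 p = p@_0.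
Proof.
rewrite {2}[p]mpolyE ev.unlock mevalE raddf_sum /=; apply: eq_bigr => m _.
rewrite mcoeffZ mcoeffX; congr (_ * _).
have [->|m0] := eqVneq m 0%MM.
  by rewrite big1 // => i _; rewrite mnm0E.
have [i mi] := mnm_neq0 m0.
by rewrite (bigD1 i) //= mxE expr0n (negbTE mi) mul0r.
Qed.

Lemma mderivXU n (i j : 'I_n) : ('X_j : {mpoly C[n]})^`M(i) = (j == i)%:R.
Proof.
rewrite mderivX mnm1E; have [->|_] := eqVneq j i; last by rewrite scale0r.
by rewrite -[X in (X - _)%MM]add0m addmK mpolyX0 scale1r.
Qed.

Lemma mderiv_pcomp k n (f : 'I_k -> {mpoly C[n]}) i p :
  (pcomp f p)^`M(i) = \sum_j pcomp f p^`M(j) * (f j)^`M(i).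
Proof.
elim/mpoly_alg_ind: p => [c|j|p q IHp IHq|p q IHp IHq].
- by rewrite pcompC mderivC big1 // => j _; rewrite mderivC rmorph0 mul0r.
- rewrite pcompX (bigD1 j) //= big1 ?addr0 => [|j' /negPf jj'].
    by rewrite mderivXU eqxx rmorph1 mul1r.
  by rewrite mderivXU eq_sym jj' rmorph0 mul0r.
- rewrite rmorphD mderivD /= IHp IHq -big_split /=; apply: eq_bigr => j _.
  by rewrite mderivD rmorphD mulrDl.
- rewrite rmorphM mderivM /= IHp IHq mulr_suml mulr_sumr -big_split /=.
  apply: eq_bigr => j _; rewrite mderivM rmorphD !rmorphM /=; ring.
Qed.

Lemma mderiv_linp n (l : 'cV[C]_n) i : (linp l)^`M(i) = (l i 0)%:MP.
Proof.
rewrite /linp raddf_sum (bigD1 i) //= big1 ?addr0 => [|j /negPf ij].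
  by rewrite mderivZ mderivXU eqxx alg_mpolyC.
by rewrite mderivZ mderivXU ij scaler0.
Qed.

Lemma mderiv_act m n (M : 'M[C]_(m, n)) i p :
  (act M p)^`M(i) = \sum_j M i j *: act M p^`M(j).
Proof.
rewrite act.unlock mderiv_pcomp; apply: eq_bigr => j _.
by rewrite mderiv_linp mxE mulrC mul_mpolyC.
Qed.

Lemma linp_homog n (l : 'cV[C]_n) : linp l \is 1.-homog.
Proof.
by rewrite rpred_sum // => j _; apply: dhomogZ; rewrite dhomogX; apply/eqP/mdeg1.
Qed.

Lemma pcomp_dhomog_mnm k n (f : 'I_k -> {mpoly C[n]}) (d : 'I_k -> nat) m :
  (forall i, f i \is (d i).-homog) ->
  pcomp f 'X_[m] \is (\sum_i d i * m i).-homog.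
Proof.
move=> fd; rewrite pcomp.unlock mmapX /mmap1.
have := @dhomog_prod n C (mdeg (n:=n)) k [tuple (d i * m i)%N | i < k]
   [tuple f i ^+ m i | i < k].
rewrite big_tuple (eq_bigr (fun i => f i ^+ m i)) => [H|i _]; last first.
  by rewrite tnth_mktuple.
rewrite (eq_bigr (fun i => tnth [tuple (d i * m i)%N | i < k] i)) => [|i _].
  rewrite -[X in X.-homog](big_tuple _ _ _ predT id); apply: H => i.
  by rewrite !tnth_mktuple; apply: dhomogMn.
by rewrite tnth_mktuple.
Qed.

Lemma act_homog m n (M : 'M[C]_(m, n)) d p :
  p \is d.-homog -> act M p \is d.-homog.
Proof.
move=> /dhomogP pd; rewrite [p]mpolyE raddf_sum /=.
rewrite big_seq rpred_sum // => mm mp; rewrite actZ; apply: dhomogZ.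
rewrite act.unlock; have := pcomp_dhomog_mnm mm (fun i => linp_homog (col i M)).
by rewrite (eq_bigr (fun i => mm i)) => [|i _]; rewrite ?mul1n // -mdegE pd.
Qed.

Lemma mderiv_homog n d i (p : {mpoly C[n]}) :
  p \is d.+1.-homog -> p^`M(i) \is d.-homog.
Proof.
move=> /dhomogP pd; rewrite /mderiv big_seq rpred_sum // => m mp.
have [mi0|mi0] := eqVneq (m i) 0%N; first by rewrite mi0 mul0r scale0r rpred0.
apply: dhomogZ; rewrite dhomogX; apply/eqP/eq_add_S.
have le1m : (U_(i) <= m)%MM by rewrite lep1mP.
by rewrite -(pd _ mp) -[in RHS](submK le1m) /= mdegD mdeg1 addn1.
Qed.

(** For [d = 0] the derivative is zero, which is homogeneous of every degree, so the truncated
    predecessor does no harm. *)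
Lemma homog_mderiv_pred n d i (p : {mpoly C[n]}) :
  p \is d.-homog -> p^`M(i) \is d.-1.-homog.
Proof.
case: d => [|d]; last exact: mderiv_homog.
move=> p0; rewrite [p]msize1_polyC ?mderivC ?rpred0 //.
rewrite msizeE; apply/bigmax_leqP_seq => m mp _.
by rewrite (dhomog_mf p0 mp).
Qed.

Lemma euler_homog n d (p : {mpoly C[n]}) :
  p \is d.-homog -> \sum_i 'X_i * p^`M(i) = d%:R *: p.
Proof.
move=> /dhomogP pd.
rewrite (eq_bigr (fun i => \sum_(m <- msupp p) ((m i)%:R * p@_m) *: 'X_[m])).
  rewrite exchange_big /= {3}[p]mpolyE scaler_sumr; apply: eq_big_seq => m mp.
  by rewrite -scaler_suml -mulr_suml scalerA -natr_sum -mdegE pd.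
move=> i _; rewrite /mderiv mulr_sumr; apply: eq_bigr => m _.
rewrite -scalerAr -mpolyXD; have [->|mi0] := eqVneq (m i) 0%N.
  by rewrite mul0r !scale0r.
by rewrite addmC submK // lep1mP.
Qed.

Lemma homog_ev n d (p : {mpoly C[n]}) c v :
  p \is d.-homog -> ev (c *: v) p = c ^+ d * ev v p.
Proof.
move=> /dhomogP pd; rewrite ev.unlock !mevalE mulr_sumr; apply: eq_big_seq => m mp.
rewrite mulrCA; congr (_ * _).
rewrite (eq_bigr (fun i => c ^+ m i * v 0 i ^+ m i)) => [|i _].
  by rewrite big_split /= prodrXr -mdegE pd.
by rewrite mxE exprMn.
Qed.

Lemma pihomog_homog_neq n d e (p : {mpoly C[n]}) :
  p \is d.-homog -> d != e -> pihomog mdeg e p = 0.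
Proof. by move=> pd ne; apply: pihomog_ne0 ne pd. Qed.

(** Multiplication by [a] raises every degree by [d]; the test is there because [k - d] is
    truncated. *)
Lemma pihomogMl n d k (a p : {mpoly C[n]}) : a \is d.-homog ->
  pihomog mdeg k (a * p) = if (d <= k)%N then a * pihomog mdeg (k - d) p else 0.
Proof.
move=> ad; elim/mpolyind: p => [|c m p _ _ IH].
  by rewrite mulr0 !pihomog0 mulr0 if_same.
rewrite mulrDr !pihomogD IH.
suff -> : pihomog mdeg k (a * (c *: 'X_[m])) =
    if (d <= k)%N then a * pihomog mdeg (k - d) (c *: 'X_[m]) else 0.
  by case: ifP => _; rewrite ?mulrDr ?addr0.
rewrite -scalerAr !linearZ /= pihomogX.
have aXd : a * 'X_[m] \is (d + mdeg m).-homog.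
  by apply: dhomogM => //; rewrite dhomogX.
have [dk|kd] := leqP d k.
  have [mk|mk] := eqVneq (mdeg m) (k - d)%N.
    rewrite pihomog_dE ?scalerAr // -(subnKC dk) -mk //.
  rewrite (pihomog_homog_neq aXd) ?scaler0 ?mulr0 //.
  by apply: contraNneq mk => <-; rewrite addKn.
rewrite (pihomog_homog_neq aXd) ?scaler0 //.
by rewrite neq_ltn; apply/orP; right; apply: leq_trans kd (leq_addr _ _).
Qed.

Lemma pihomog_act m n (M : 'M[C]_(m, n)) d p :
  pihomog mdeg d (act M p) = act M (pihomog mdeg d p).
Proof.
elim/mpolyind: p => [|c mm p _ _ IH]; first by rewrite !(pihomog0, rmorph0).
rewrite rmorphD !pihomogD rmorphD /= IH; congr (_ + _).
rewrite actZ !linearZ /= pihomogX actZ; congr (_ *: _).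
have aX : act M 'X_[mm] \is (mdeg mm).-homog by apply: act_homog; rewrite dhomogX.
have [md|md] := eqVneq; first by rewrite -md pihomog_dE.
by rewrite (pihomog_homog_neq aX) ?rmorph0.
Qed.

Lemma pihomog0_ev n (p : {mpoly C[n]}) : pihomog mdeg 0 p = (ev 0 p)%:MP.
Proof.
apply/mpolyP => m; rewrite ev0E mcoeffC.
have [->|m0] := eqVneq m 0%MM; last first.
  rewrite mulr0; apply: (dhomog_nemf_coeff (pihomogP mdeg 0 p)).
  by rewrite mdeg_eq0.
have pE := pihomog_partitionE (leqnSn (mmeasure mdeg p)).
rewrite mulr1 [in RHS]pE big_ord_recl mcoeffD.
rewrite [X in _ = _ + X]raddf_sum [X in _ = _ + X]big1 ?addr0 // => i _.
apply: (dhomog_nemf_coeff (pihomogP mdeg _ p)).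
by change (mdeg (0%MM : 'X_{1..n}) != i.+1); rewrite mdeg0.
Qed.

Lemma homog_ev0 n d (p : {mpoly C[n]}) :
  p \is d.-homog -> (0 < d)%N -> ev 0 p = 0.
Proof.
move=> pd d0; rewrite ev0E; apply: (dhomog_nemf_coeff pd).
by change (mdeg (0%MM : 'X_{1..n}) != d); rewrite mdeg0 ltn_eqF.
Qed.

End Evaluation.

(** * Restriction of polynomials to lines *)

HB.lock Definition lineP (C : comNzRingType) n (u : 'rV[C]_n)
    (p : {mpoly C[n]}) : {poly {mpoly C[n]}} :=
  mmap (polyC \o @mpolyC n C) (fun j => ('X_j)%:P + (u 0 j)%:MP *: 'X) p.

(** [lineP] expands [p(X + s u)] in powers of [s] at a generic base point [X], here specialised to
    [v]. The generic form permits one division with remainder for all base points at once. *)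
HB.lock Definition line (C : comNzRingType) n (v u : 'rV[C]_n)
    (p : {mpoly C[n]}) : {poly C} := map_poly (ev v) (lineP u p).

Section Line.
Variable C : comNzRingType.

Lemma linePC n (u : 'rV[C]_n) c : lineP u c%:MP = (c%:MP)%:P.
Proof. by rewrite lineP.unlock mmapC. Qed.

Lemma linePX n (u : 'rV[C]_n) j : lineP u 'X_j = ('X_j)%:P + (u 0 j)%:MP *: 'X.
Proof. by rewrite lineP.unlock mmapX mmap1U. Qed.

Lemma linePD n (u : 'rV[C]_n) : {morph lineP u : p q / p + q}.
Proof. by move=> p q; rewrite lineP.unlock; exact: mmapD. Qed.

Lemma linePM n (u : 'rV[C]_n) : {morph lineP u : p q / p * q}.
Proof. by move=> p q; rewrite lineP.unlock; exact: rmorphM. Qed.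

Lemma lineP_zmod n (u : 'rV[C]_n) : zmod_morphism (lineP u).
Proof. by move=> p q; rewrite lineP.unlock; exact: rmorphB. Qed.

Lemma lineP_monoid n (u : 'rV[C]_n) : monoid_morphism (lineP u).
Proof. by split=> [|p q]; rewrite lineP.unlock; [exact: rmorph1|exact: rmorphM]. Qed.

HB.instance Definition _ n (u : 'rV[C]_n) :=
  GRing.isZmodMorphism.Build _ _ (lineP u) (lineP_zmod u).
HB.instance Definition _ n (u : 'rV[C]_n) :=
  GRing.isMonoidMorphism.Build _ _ (lineP u) (lineP_monoid u).

Lemma lineP0 n (u : 'rV[C]_n) p : (lineP u p).[0] = p.
Proof.
elim/mpoly_alg_ind: p => [c|i|p q IHp IHq|p q IHp IHq].
- by rewrite linePC hornerC.
- by rewrite linePX hornerD hornerC hornerZ hornerX mulr0 addr0.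
- by rewrite linePD hornerD IHp IHq.
- by rewrite linePM hornerM IHp IHq.
Qed.

Lemma lineC n (v u : 'rV[C]_n) c : line v u c%:MP = c%:P.
Proof. by rewrite line.unlock linePC map_polyC /= evC. Qed.

Lemma lineX n (v u : 'rV[C]_n) j : line v u 'X_j = (v 0 j)%:P + u 0 j *: 'X.
Proof.
rewrite line.unlock linePX rmorphD /= map_polyC /= evX.
by rewrite map_polyZ map_polyX /= evC.
Qed.

Lemma lineD n (v u : 'rV[C]_n) : {morph line v u : p q / p + q}.
Proof. by move=> p q; rewrite line.unlock linePD rmorphD. Qed.

Lemma lineM n (v u : 'rV[C]_n) : {morph line v u : p q / p * q}.
Proof. by move=> p q; rewrite line.unlock linePM rmorphM. Qed.

Lemma line0 n (v u : 'rV[C]_n) : line v u 0 = 0.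
Proof. by rewrite -mpolyC0 lineC. Qed.

Lemma line1 n (v u : 'rV[C]_n) : line v u 1 = 1.
Proof. by rewrite -mpolyC1 lineC. Qed.

Lemma lineXn n (v u : 'rV[C]_n) p k : line v u (p ^+ k) = line v u p ^+ k.
Proof. by elim: k => [|k IH]; rewrite ?line1 // !exprS lineM IH. Qed.

Lemma horner_line n (v u : 'rV[C]_n) p t : (line v u p).[t] = ev (v + t *: u) p.
Proof.
elim/mpoly_alg_ind: p => [c|i|p q IHp IHq|p q IHp IHq].
- by rewrite lineC hornerC evC.
- by rewrite lineX !hornerE evX !mxE mulrC.
- by rewrite lineD hornerD IHp IHq rmorphD.
- by rewrite lineM hornerM IHp IHq rmorphM.
Qed.

Lemma deriv_line n (v u : 'rV[C]_n) p :
  (line v u p)^`() = \sum_j u 0 j *: line v u p^`M(j).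
Proof.
elim/mpoly_alg_ind: p => [c|i|p q IHp IHq|p q IHp IHq].
- by rewrite lineC derivC big1 // => j _; rewrite mderivC line0 scaler0.
- rewrite lineX !derivE (bigD1 i) //= big1 ?addr0 => [|j /negPf ij].
    by rewrite mderivXU eqxx line1 add0r.
  by rewrite mderivXU eq_sym ij line0 scaler0.
- rewrite lineD derivD IHp IHq -big_split /=; apply: eq_bigr => j _.
  by rewrite mderivD lineD scalerDr.
- rewrite lineM derivM IHp IHq mulr_suml mulr_sumr -big_split /=.
  apply: eq_bigr => j _; rewrite mderivM lineD !lineM scalerDr.
  by rewrite -scalerAl -scalerAr.
Qed.

End Line.

(** * Polynomial identities tested on values, in characteristic zero *)

Section Field.
Variable C : numClosedFieldType.

(** The integers from [1] to [size p] are distinct roots, more than a nonzero [p] can have. The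
    point [0] is left out for identities in a parameter that has to be inverted. *)
Lemma poly_eval0 (p : {poly C}) : (forall t, t != 0 -> p.[t] = 0) -> p = 0.
Proof.
move=> p0; apply/eqP; apply: contraT => pn0.
have := max_poly_roots pn0 (rs := [seq k.+1%:R | k <- iota 0 (size p)]).
rewrite size_map size_iota ltnn; apply => //.
  by apply/allP => _ /mapP[k _ ->]; apply/eqP/p0; rewrite pnatr_eq0.
by rewrite map_inj_uniq ?iota_uniq // => i j /eqP; rewrite eqr_nat eqSS => /eqP.
Qed.

Lemma msize_mderiv n (p : {mpoly C[n]}) i :
  p^`M(i) != 0 -> (msize p^`M(i) < msize p)%N.
Proof.
move=> dn0; rewrite -(mlead_deg dn0); set m := mlead _.
have : m \in msupp p^`M(i) by exact: mlead_supp.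
rewrite mcoeff_msupp mcoeff_deriv => H.
have /msize_mdeg_lt : (m + U_(i))%MM \in msupp p.
  by rewrite mcoeff_msupp; apply: contraNneq H => ->; rewrite mul0rn.
by rewrite mdegD mdeg1 addn1.
Qed.

Lemma mderiv_eq0 n (p : {mpoly C[n]}) :
  (forall i, p^`M(i) = 0) -> p = (ev 0 p)%:MP.
Proof.
move=> dp0; apply/mpolyP => m; rewrite mcoeffC.
have [->|m0] := eqVneq m 0%MM; first by rewrite mulr1 ev0E.
rewrite mulr0; have [i mi] := mnm_neq0 m0.
have le1m : (U_(i) <= m)%MM by rewrite lep1mP.
have := mcoeff_deriv i (m - U_(i))%MM p; rewrite dp0 mcoeff0 submK //.
by move/eqP; rewrite eq_sym mulrn_eq0 /= => /eqP.
Qed.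

(** Vanishing everywhere passes to the partial derivatives, read off along coordinate lines; by
    induction on the size these are zero, and a constant remains. *)
Lemma ev_eq0 n (p : {mpoly C[n]}) : (forall v, ev v p = 0) -> p = 0.
Proof.
have [k] := ubnP (msize p); elim: k p => // k IH p; rewrite ltnS => sp p0.
rewrite [p]mderiv_eq0 ?p0 // => i.
have dv v : ev v p^`M(i) = 0.
  have l0 : line v (delta_mx 0 i) p = 0.
    by apply: poly_eval0 => t _; rewrite horner_line p0.
  have := congr1 (fun q => q.[0]) (deriv_line v (delta_mx 0 i) p).
  rewrite l0 deriv0 horner0 horner_sum (bigD1 i) //= big1 ?addr0 => [|j ij].
    by rewrite hornerZ mxE !eqxx mul1r horner_line scale0r addr0.
  by rewrite hornerZ mxE (negPf ij) mul0r.
have [//|dn0] := eqVneq (p^`M(i)) 0.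
by apply: IH => //; apply: leq_trans (msize_mderiv dn0) sp.
Qed.

Lemma ev_inj n (p q : {mpoly C[n]}) : (forall v, ev v p = ev v q) -> p = q.
Proof.
move=> pq; apply/eqP; rewrite -subr_eq0; apply/eqP/ev_eq0 => v.
by rewrite rmorphB /= pq subrr.
Qed.

Lemma ev_neq0 n (p : {mpoly C[n]}) : p != 0 -> exists v, ev v p != 0.
Proof.
move=> pn0; apply/not_existsP => H; case/eqP: pn0; apply: ev_eq0 => v.
by apply/eqP; apply/negP => /negP/H.
Qed.

End Field.

(** * Divisibility by powers in polynomial rings *)

Section Divisibility.
Variable C : numClosedFieldType.

(** Dividing both by their gcd [g], the cofactor of [d] becomes coprime to that of [N], so all its
    powers divide [g]; by degree it is a constant. *)
Lemma dvdp_powers (d N : {poly C}) : d != 0 ->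
  (forall k, d ^+ k %| N ^+ k.+1) -> d %| N.
Proof.
move=> d0 dk; set g := gcdp d N.
have g0 : g != 0 by rewrite gcdp_eq0 (negPf d0).
have dE : d = (d %/ g) * g by rewrite divpK // dvdp_gcdl.
have NE : N = (N %/ g) * g by rewrite divpK // dvdp_gcdr.
have cop : coprimep (d %/ g) (N %/ g) by apply: coprimep_div_gcd; rewrite d0.
have dg k : (d %/ g) ^+ k %| g.
  move: (dk k); rewrite [X in X ^+ _ %| _]dE [X in _ %| X ^+ _]NE !exprMn.
  rewrite [g ^+ k.+1]exprS mulrA dvdp_mul2r ?expf_neq0 // Gauss_dvdpr //.
  by rewrite coprimep_expl // coprimep_expr.
have dg0 : d %/ g != 0 by apply: contraNneq d0 => dg0; rewrite dE dg0 mul0r.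
have : size (d %/ g) == 1%N.
  have := dvdp_leq g0 (dg (size g)).
  have := size_exp (d %/ g) (size g).
  have : (0 < size g)%N by rewrite size_poly_gt0.
  move: dg0; rewrite -size_poly_gt0.
  case: (size (d %/ g)) => [|[|s]] //= _.
  set e := size (polyseq (_ ^+ _)); move: e (size g) => e k k0 eE ek.
  have : (k <= e.-1)%N by rewrite eE mulSn leq_addr.
  by case: e eE ek => [|e] /= eE ek ke; lia.
rewrite size_poly_eq1 => dg1.
by rewrite dE (eqp_dvdl _ (eqp_mulr _ dg1)) mul1r dvdp_gcdr.
Qed.

(** Degree [d] in [s] is reached only by taking the summand [s u] in every factor of a monomial of
    degree [d]. The coefficient is thus a constant, which allows normalising to a monic
    polynomial. *)
Lemma lineP_top n (u : 'rV[C]_n) d (p : {mpoly C[n]}) : (msize p <= d.+1)%N ->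
  (size (lineP u p) <= d.+1)%N /\
  (lineP u p)`_d = (ev u (pihomog mdeg d p))%:MP.
Proof.
pose Q d (q : {poly {mpoly C[n]}}) (c : C) := (size q <= d.+1)%N /\ q`_d = c%:MP.
have QM d1 d2 q1 q2 c1 c2 : Q d1 q1 c1 -> Q d2 q2 c2 -> Q (d1 + d2)%N (q1 * q2) (c1 * c2).
  case=> s1 e1 [s2 e2]; split.
    by apply: leq_trans (size_polyMleq _ _) _; rewrite -ltnS; lia.
  rewrite coefM (bigD1 (Ordinal (leq_addr d2 d1 : (d1 < (d1 + d2).+1)%N))) //=.
  rewrite addKn e1 e2 -mpolyCM big1 ?addr0 // => j.
  rewrite -val_eqE /= => jd.
  have [jlt|jge] := ltnP j d1.
    by rewrite [q2`_ _]nth_default ?mulr0 //; apply: leq_trans s2 _; lia.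
  by rewrite [q1`_ _]nth_default ?mul0r //; apply: leq_trans s1 _; lia.
have Qm m : Q (mdeg m) (lineP u 'X_[m]) (ev u 'X_[m]).
  rewrite mpolyXE_id mdegE !rmorph_prod /=.
  elim/big_rec3: _ => [|i y1 y2 y3 _ IH].
    by rewrite /Q size_poly1 coef1.
  apply: (QM) => //; rewrite !rmorphXn /= evX linePX.
  elim: (m i) => [|k IHk]; first by rewrite /Q size_poly1 coef1.
  rewrite !exprS -[k.+1]add1n; apply: (QM) => //; split.
    apply: leq_trans (size_polyD _ _) _; rewrite geq_max.
    rewrite (leq_trans (size_polyC_leq1 _)) //.
    by apply: leq_trans (size_scale_leq _ _) _; rewrite size_polyX.
  by rewrite coefD coefC coefZ coefX add0r mulr1.
move=> sp; split.
  rewrite [p]mpolyE raddf_sum /=; apply: leq_trans (size_sum _ _ _) _.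
  apply/bigmax_leqP_seq => m mp _.
  rewrite -mul_mpolyC linePM linePC mul_polyC.
  apply: leq_trans (size_scale_leq _ _) _.
  apply: leq_trans (Qm m).1 _; exact: leq_trans (msize_mdeg_lt mp) sp.
have -> : lineP u p = \sum_(m <- msupp p) lineP u (p@_m *: 'X_[m]).
  by rewrite -raddf_sum -mpolyE.
rewrite coef_sum /pihomog (raddf_sum (ev u)) (raddf_sum (@mpolyC n C)) /=.
rewrite [RHS]big_mkcond; apply: eq_big_seq => m mp.
rewrite -mul_mpolyC linePM linePC mul_polyC coefZ.
case: ifP => [/eqP md|/negbT md].
  by rewrite -md (Qm m).2 -mpolyCM; congr (_%:MP); rewrite rmorphM /= evC.
rewrite [X in _ * X]nth_default ?mulr0 //; apply: leq_trans (Qm m).1 _.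
by move: md (leq_trans (msize_mdeg_lt mp) sp); rewrite ltnS /= => H1 H2; rewrite ltn_neqAle H1.
Qed.

(* On a line in a suitable direction u, d becomes monic in the parameter, up to
   a constant; the remainder of the division of N by d vanishes at every point
   because it does so for polynomials in one variable. *)
Lemma mdvd_powers n (d N : {mpoly C[n]}) : d != 0 ->
    (forall k, exists M, N ^+ k.+1 = d ^+ k * M) ->
  exists Q, N = Q * d.
Proof.
move=> d0 dk.
set D := (msize d).-1.
have sd : msize d = D.+1 by rewrite /D prednK // lt0n msize_poly_eq0.
have dD0 : pihomog mdeg D d != 0.
  apply/eqP => /(congr1 (fun p => p@_(mlead d))); rewrite mcoeff0 => H.
  have : d@_(mlead d) = 0.
    rewrite [X in X@_ _](pihomog_partitionE (leqnn (msize d))) raddf_sum /=.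
    rewrite sd big_ord_recr /= H addr0 big1 // => i _.
    apply: (dhomog_nemf_coeff (pihomogP mdeg _ d)).
    have /eqP := mlead_deg d0; rewrite sd eqSS => /eqP e.
    by change (mdeg (mlead d) != i); rewrite e gtn_eqF.
  by move/eqP; rewrite mleadc_eq0 (negPf d0).
have [u cu] := ev_neq0 dD0; set c := ev u _ in cu.
have sdD : (msize d <= D.+1)%N by rewrite sd.
have [sL tL] := lineP_top u sdD; rewrite -/c in tL.
set L := lineP u d in sL tL.
pose L' := (c^-1)%:MP_[n] *: L.
have cL' : L'`_D = 1 by rewrite coefZ tL -mpolyCM mulVf.
have sL' : size L' = D.+1.
  apply/eqP; rewrite eqn_leq (leq_trans (size_scale_leq _ _)) //= ltnNge.
  apply/negP => /leq_sizeP/(_ _ (leqnn D)) /eqP; rewrite cL' oner_eq0 //.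
have mL' : L' \is monic by rewrite monicE lead_coefE sL' /= cL'.
have dP := Pdiv.RingMonic.rdivp_eq mL' (lineP u N).
set Q := Pdiv.Ring.rdivp _ _ in dP; set R := Pdiv.Ring.rmodp _ _ in dP.
have sR : (size R < D.+1)%N by rewrite -sL'; apply: Pdiv.Ring.ltn_rmodpN0; rewrite monic_neq0.
have R0 : R = 0.
  apply/polyP => i; rewrite coef0; apply: ev_eq0 => v.
  have mLv : map_poly (ev v) L' \is monic by apply: monic_map.
  have LvE : map_poly (ev v) L' = c^-1 *: line v u d by rewrite map_polyZ /= evC line.unlock.
  have Lv0 : line v u d != 0.
    by apply: contraTneq mLv => e; rewrite LvE e scaler0 monicE lead_coef0 eq_sym oner_eq0.
  have dv : line v u d %| line v u N.
    apply: dvdp_powers => // k; have [M HM] := dk k.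
    have := congr1 (line v u) HM; rewrite lineXn lineM lineXn => ->.
    exact: dvdp_mulr.
  have : map_poly (ev v) L' %| map_poly (ev v) R.
    have -> : map_poly (ev v) R = line v u N - map_poly (ev v) Q * map_poly (ev v) L'.
      by rewrite line.unlock dP rmorphD rmorphM /= addrC addKr.
    rewrite dvdp_sub ?dvdp_mull // LvE dvdpZl // invr_neq0 //.
  move=> dR; suff : map_poly (ev v) R = 0.
    by move/(congr1 (fun q : {poly C} => q`_i)); rewrite coef_map coef0.
  apply/eqP; apply: contraTT dR => Rv0; apply/negP => /(dvdp_leq Rv0).
  rewrite leqNgt => /negP; apply.
  apply: leq_ltn_trans (size_poly _ _) _.
  by rewrite size_map_poly_id0 ?sL' // (monicP mL') rmorph1 oner_neq0.
(* Setting the parameter to [0] recovers [N] and [d] by [lineP0]; [c^-1] comes from the monic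
   normalisation [L']. *)
exists (Q.[0] * (c^-1)%:MP).
have := congr1 (fun q => q.[0]) dP; rewrite R0 addr0 hornerM hornerZ !lineP0.
by rewrite mulrA.
Qed.

End Divisibility.

(** * Generic points *)

Section Generic.
Variable C : numClosedFieldType.

Lemma col_mulmx m n k (A : 'M[C]_(m, n)) (B : 'M[C]_(n, k)) j :
  A *m col j B = col j (A *m B).
Proof. by rewrite !colE mulmxA. Qed.

(** The product of the [f i] is a nonzero polynomial, hence nonzero somewhere. The general position
    arguments below rest on this. *)
Lemma generic_point n (I : finType) (P : pred I) (f : I -> {mpoly C[n]}) :
  (forall i, P i -> f i != 0) -> exists v, forall i, P i -> ev v (f i) != 0.
Proof.
move=> f0; have /ev_neq0[v] : \prod_(i | P i) f i != 0 by apply/prodf_neq0.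
by rewrite rmorph_prod /= => /prodf_neq0 H; exists v.
Qed.

Lemma col_form_neq0 n (l : 'cV[C]_n) : l != 0 ->
  exists b : 'rV[C]_n, b *m l = 1%:M.
Proof.
case/cV0Pn => i li; exists ((l i 0)^-1 *: delta_mx 0 i).
by rewrite -scalemxAl -rowE; apply/matrixP => x y; rewrite !ord1 !mxE mulVf.
Qed.

Lemma linp_neq0 n (l : 'cV[C]_n) : l != 0 -> linp l != 0.
Proof.
apply: contraNneq => l0; apply/eqP/colP => i.
have := ev_linp l (delta_mx 0 i); rewrite l0 rmorph0 -rowE !mxE.
by move=> <-.
Qed.

Lemma proper_subspace_form n m (X : 'M[C]_(m, n)) : (\rank X < n)%N ->
  exists2 l : 'cV[C]_n, l != 0 & X *m l = 0.
Proof.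
move=> rX; have : kermx X^T != 0.
  by rewrite -mxrank_eq0 mxrank_ker mxrank_tr subn_eq0 -ltnNge.
case/rowV0Pn => w /sub_kermxP wX w0; exists w^T.
  by apply: contraNneq w0 => e; rewrite -[w]trmxK e trmx0.
by apply: trmx_inj; rewrite trmx_mul trmxK wX trmx0.
Qed.

Lemma notin_subspace n m (X : 'M[C]_(m, n)) (v : 'rV[C]_n) : ~~ (v <= X)%MS ->
  exists2 l : 'cV[C]_n, (v *m l) 0 0 != 0 & X *m l = 0.
Proof.
rewrite submxE => /rV0Pn[j vj].
exists (col j (cokermx X)).
  by rewrite col_mulmx mxE.
by rewrite col_mulmx mulmx_coker; apply/colP => i; rewrite !mxE.
Qed.

Lemma generic_vector n (I : finType) (P : pred I) (X : I -> 'M[C]_n) :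
  (forall i, P i -> (\rank (X i) < n)%N) ->
  exists v : 'rV[C]_n, forall i, P i -> ~~ (v <= X i)%MS.
Proof.
move=> rX.
have /choice[l lP] i : exists l : 'cV[C]_n, P i -> l != 0 /\ X i *m l = 0.
  case Pi: (P i); last by exists 0.
  by have [l l0 Xl] := proper_subspace_form (rX i Pi); exists l.
have [i Pi|v vP] := @generic_point n I P (fun i => linp (l i)).
  exact: linp_neq0 (lP i Pi).1.
exists v => i Pi; apply: contraNN (vP i Pi) => /submxP[a ->].
by rewrite ev_linp -mulmxA (lP i Pi).2 mulmx0 mxE.
Qed.

(** If [Q] has no zero on the line [u + t p], it is a constant [c] there, and homogeneity gives
    [Q(p + s u) = c s^d], which is zero at [s = 0]. Homogeneity is stated on values for nonzero
    scalars because it will come from a division. *)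
Lemma plane_zero n (Q : {mpoly C[n]}) d (p u : 'rV[C]_n) : (0 < d)%N ->
    (forall c v, c != 0 -> ev (c *: v) Q = c ^+ d * ev v Q) ->
  (exists t, ev (u + t *: p) Q = 0) \/ ev p Q = 0.
Proof.
move=> d0 hQ; set L := line u p Q.
have [/eqP s1|/closed_rootP[t /rootP]] := boolP (size L == 1%N); last first.
  by rewrite horner_line; left; exists t.
right; have [c _ Lc] := size_poly1P _ (introT eqP s1).
have : line p u Q - c *: 'X^d = 0.
  apply: poly_eval0 => s s0; rewrite hornerD hornerN hornerZ hornerXn horner_line.
  have -> : p + s *: u = s *: (u + s^-1 *: p).
    by rewrite scalerDr scalerA divff // scale1r addrC.
  by rewrite hQ // -horner_line -/L Lc hornerC mulrC subrr.
move/eqP; rewrite subr_eq0 => /eqP/(congr1 (fun q => q.[0])).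
by rewrite horner_line scale0r addr0 hornerZ hornerXn expr0n gtn_eqF // mulr0.
Qed.

(** Choose [p] outside every [X i], then [u] outside every [X i + p], which is still proper. Neither
    [p] nor any [u + t p] lies in some [X i], and [plane_zero] finds a zero among them. *)
Lemma zero_off_codim2 n (Q : {mpoly C[n]}) d (I : finType) (P : pred I)
    (X : I -> 'M[C]_n) : (0 < d)%N ->
    (forall c v, c != 0 -> ev (c *: v) Q = c ^+ d * ev v Q) ->
    (forall i, P i -> ((\rank (X i)).+1 < n)%N) ->
  exists2 v, ev v Q = 0 & forall i, P i -> ~~ (v <= X i)%MS.
Proof.
move=> d0 hQ rX.
have [i /rX|p pP] := @generic_vector n I P X; first exact: ltnW.
have [i /rX|u uP] := @generic_vector n I P (fun i => X i + p)%MS.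
  apply: leq_ltn_trans; apply: leq_trans (mxrank_adds_leqif _ _) _.
  by have := rank_leq_row p; rewrite -(leq_add2l (\rank (X i))) addn1.
have [[t tQ]|pQ] := plane_zero p u d0 hQ; last by exists p.
exists (u + t *: p) => // i /uP; apply: contraNN => H.
have -> : u = (u + t *: p) + (- t) *: p by rewrite scaleNr addrK.
exact: addmx_sub_adds H (scalemx_sub _ (submx_refl _)).
Qed.

(** The matrix fixes the hyperplane of [l] pointwise, so [p] changes by a multiple of [linp l]. The
    quotient [q] is the divided difference of Chevalley's argument. *)
Lemma act_rank1 n (l : 'cV[C]_n) (b : 'rV[C]_n) p :
  exists q, act (1%:M + l *m b) p = p + linp l * q.
Proof.
elim/mpoly_alg_ind: p => [c|i|p q [p' IHp] [q' IHq]|p q [p' IHp] [q' IHq]].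
- by exists 0; rewrite actC mulr0 addr0.
- exists (b 0 i)%:MP; apply: ev_inj => v.
  rewrite actX ev_linp rmorphD rmorphM /= evX evC ev_linp col_mulmx mxE.
  rewrite mulmxDr mulmx1 mxE mulmxA; congr (_ + _).
  by rewrite mxE big_ord1.
- by exists (p' + q'); rewrite rmorphD /= IHp IHq; ring.
- exists (p' * q + p * q' + linp l * p' * q'); rewrite rmorphM /= IHp IHq; ring.
Qed.

(** With [b *m l = 1], the matrix [1%:M - l *m b] projects onto the hyperplane, so the pullback of
    [p] is zero and [act_rank1] gives the quotient. *)
Lemma linp_dvd n (l : 'cV[C]_n) p : l != 0 ->
  (forall v : 'rV[C]_n, v *m l = 0 -> ev v p = 0) -> exists q, p = linp l * q.
Proof.
move=> l0 pl; have [b bl] := col_form_neq0 l0.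
have [q qE] := act_rank1 l (- b) p.
exists (- q); rewrite mulrN; apply/eqP; rewrite -addr_eq0 -qE; apply/eqP.
apply: ev_eq0 => v; rewrite ev_act; apply: pl.
by rewrite mulmxN mulmxDr mulmx1 mulmxDl mulmxN mulNmx -!mulmxA bl mulmx1 subrr.
Qed.

(* The square factors make the polynomial vanish to second order on s. *)
Lemma separating_poly n (v : 'rV[C]_n) (s : seq 'rV[C]_n) : v \notin s ->
  exists2 q, ev v q = 1 &
    forall w, w \in s -> ev w q = 0 /\ forall i, ev w q^`M(i) = 0.
Proof.
elim: s => [|w s IH]; first by exists 1; rewrite ?rmorph1.
rewrite inE negb_or => /andP[vw /IH[q q1 qs]].
have [k] : exists k, (v - w) 0 k != 0 by apply/rV0Pn; rewrite subr_eq0.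
rewrite !mxE => vk.
pose a : {mpoly C[n]} := (v 0 k - w 0 k)^-1 *: ('X_k - (w 0 k)%:MP).
have av : ev v a = 1 by rewrite evZ rmorphB /= evX evC mulVf.
have aw : ev w a = 0 by rewrite evZ rmorphB /= evX evC subrr mulr0.
exists (a * a * q); first by rewrite !rmorphM /= av q1 !mulr1.
move=> x; rewrite inE => /predU1P[->|/qs[qx dqx]].
  split=> [|j]; first by rewrite !rmorphM /= aw !mul0r.
  by rewrite !mderivM !(rmorphD, rmorphM) /= aw !(mulr0, mul0r) !addr0 mul0r.
split=> [|j]; first by rewrite rmorphM /= qx mulr0.
by rewrite mderivM rmorphD !rmorphM /= qx dqx !mulr0 addr0.
Qed.

End Generic.

(** * Invariants of finite linear groups *)

Section Invariants.
Variables (C : numClosedFieldType) (gT : finGroupType) (G : {group gT}) (n : nat).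
Variable rG : mx_representation C G n.

Definition invp (p : {mpoly C[n]}) := forall x, x \in G -> act (rG x) p = p.

(** The Reynolds operator: a projection onto the invariants, linear over them ([avg_id],
    [avgMr]). *)
Definition avg (p : {mpoly C[n]}) := #|G|%:R^-1 *: \sum_(x in G) act (rG x) p.

Lemma act1 m (p : {mpoly C[m]}) : act 1%:M p = p.
Proof. by apply: ev_inj => v; rewrite ev_act mulmx1. Qed.

Lemma act_mulmx k l m (M : 'M[C]_(k, l)) (M' : 'M[C]_(l, m)) p :
  act (M *m M') p = act M (act M' p).
Proof. by apply: ev_inj => v; rewrite !ev_act mulmxA. Qed.

Lemma act_repr x y p : x \in G -> y \in G ->
  act (rG (x * y)%g) p = act (rG x) (act (rG y) p).
Proof. by move=> Gx Gy; rewrite repr_mxM // act_mulmx. Qed.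

Lemma ev_repr v x p : invp p -> x \in G -> ev (v *m rG x) p = ev v p.
Proof. by move=> ip Gx; rewrite -ev_act ip. Qed.

Lemma invpC c : invp c%:MP.
Proof. by move=> x _; rewrite actC. Qed.

Lemma invpD p q : invp p -> invp q -> invp (p + q).
Proof. by move=> ip iq x Gx; rewrite rmorphD /= ip ?iq. Qed.

Lemma invpM p q : invp p -> invp q -> invp (p * q).
Proof. by move=> ip iq x Gx; rewrite rmorphM /= ip ?iq. Qed.

Lemma invpZ c p : invp p -> invp (c *: p).
Proof. by move=> ip x Gx; rewrite actZ ip. Qed.

Lemma invp_pihomog d p : invp p -> invp (pihomog mdeg d p).
Proof. by move=> ip x Gx; rewrite -pihomog_act ip. Qed.

Lemma invp_pcomp k (f : 'I_k -> {mpoly C[n]}) p :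
  (forall i, invp (f i)) -> invp (pcomp f p).
Proof.
move=> jf x Gx; rewrite act.unlock pcomp_pcomp; apply: eq_pcomp => i.
by have := jf i x Gx; rewrite act.unlock.
Qed.

Lemma card_neq0 : #|G|%:R != 0 :> C.
Proof. by rewrite pnatr_eq0 -lt0n cardG_gt0. Qed.

Lemma sum_act_inv p : invp (\sum_(x in G) act (rG x) p).
Proof.
move=> y Gy; rewrite raddf_sum (reindex_inj (mulgI y^-1%g)) /=.
apply: eq_big => [x|x yx]; first by rewrite groupMl ?groupV.
by rewrite -act_repr ?mulKVg.
Qed.

Lemma avg_inv p : invp (avg p).
Proof. by apply: invpZ; exact: sum_act_inv. Qed.

Lemma avg_id p : invp p -> avg p = p.
Proof.
move=> ip; rewrite /avg (eq_bigr (fun=> p)) => [|x /ip //].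
by rewrite sumr_const -scaler_nat scalerA mulVf ?scale1r ?card_neq0.
Qed.

Lemma avgMr p q : invp q -> avg (p * q) = avg p * q.
Proof.
move=> iq; rewrite /avg -scalerAl mulr_suml; congr (_ *: _).
by apply: eq_bigr => x Gx; rewrite rmorphM /= iq.
Qed.

Lemma avgZ c p : avg (c *: p) = c *: avg p.
Proof.
rewrite /avg (eq_bigr (fun x => c *: act (rG x) p)) => [|x _]; last exact: actZ.
by rewrite -scaler_sumr !scalerA mulrC.
Qed.

Lemma avg_sum I (r : seq I) (P : pred I) F :
  avg (\sum_(i <- r | P i) F i) = \sum_(i <- r | P i) avg (F i).
Proof.
rewrite /avg -scaler_sumr; congr (_ *: _); rewrite [RHS]exchange_big /=.
by apply: eq_bigr => x Gx; rewrite raddf_sum.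
Qed.

Lemma avg_homog d p : p \is d.-homog -> avg p \is d.-homog.
Proof.
by move=> pd; apply: dhomogZ; apply: rpred_sum => x _; apply: act_homog.
Qed.

(** If [q] is [1] at [w] and [0] on the orbit of [v], the product of the conjugates of [1 - q] is an
    invariant equal to [1] at [v] and [0] at [w]. *)
Lemma invariants_separate v w : (forall p, invp p -> ev v p = ev w p) ->
  exists2 x, x \in G & w = v *m rG x.
Proof.
move=> vw; pose s := [seq v *m rG x | x in G].
have [/imageP[x Gx ->]|/separating_poly[q qw qs]] := boolP (w \in s).
  by exists x.
pose h := \prod_(x in G) (1 - act (rG x) q).
have ih : invp h.
  move=> y Gy; rewrite rmorph_prod /= /h (reindex_inj (mulgI y^-1%g)) /=.
  apply: eq_big => [x|x yx]; first by rewrite groupMl ?groupV.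
  by rewrite rmorphB rmorph1 /= -act_repr ?mulKVg.
have := vw h ih; rewrite !rmorph_prod /= [in LHS]big1 => [|x Gx]; last first.
  rewrite rmorphB rmorph1 /= ev_act (qs _ _).1 ?subr0 //.
  by apply/imageP; exists x.
move/esym/eqP; suff -> : \prod_(x in G) ev w (1 - act (rG x) q) = 0.
  by rewrite eq_sym oner_eq0.
apply/eqP/prodf_eq0; exists 1%g => //.
by rewrite rmorphB rmorph1 /= repr_mx1 act1 qw subrr.
Qed.

Section IdealOf.
Variables (I : finType) (f : I -> {mpoly C[n]}).

Definition in_ideal (P : pred I) p := exists c : I -> {mpoly C[n]},
  p = \sum_(i | P i) c i * f i.

Lemma in_ideal_gen (P : pred I) i : P i -> in_ideal P (f i).
Proof.
move=> Pi; exists (fun j => (j == i)%:R); rewrite (bigD1 i) //= eqxx mul1r.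
by rewrite big1 ?addr0 // => j /andP[_ /negPf->]; rewrite mul0r.
Qed.

Lemma in_ideal0 P : in_ideal P 0.
Proof. by exists (fun=> 0); rewrite big1 // => i _; rewrite mul0r. Qed.

Lemma in_idealD P p q : in_ideal P p -> in_ideal P q -> in_ideal P (p + q).
Proof.
move=> [c ->] [e ->]; exists (fun i => c i + e i).
by rewrite -big_split; apply: eq_bigr => i _; rewrite mulrDl.
Qed.

Lemma in_idealM P p q : in_ideal P q -> in_ideal P (p * q).
Proof.
move=> [c ->]; exists (fun i => p * c i).
by rewrite mulr_sumr; apply: eq_bigr => i _; rewrite mulrA.
Qed.

Lemma in_idealZ P a q : in_ideal P q -> in_ideal P (a *: q).
Proof. by rewrite -mul_mpolyC; apply: in_idealM. Qed.

Lemma in_ideal_sum P J (r : seq J) (Q : pred J) F :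
  (forall j, Q j -> in_ideal P (F j)) -> in_ideal P (\sum_(j <- r | Q j) F j).
Proof.
by move=> H; apply: (big_ind (in_ideal P)) => //; [exact: in_ideal0 | exact: in_idealD].
Qed.

(** Take the component of degree [d0] of the relation. Coefficients with [d0 < d i] have to be set
    to zero by hand, since [d0 - d i] is truncated. *)
Lemma in_ideal_homog P (d : I -> nat) d0 p : (forall i, f i \is (d i).-homog) ->
    p \is d0.-homog -> in_ideal P p ->
  exists c, [/\ forall i, (d i <= d0)%N -> c i \is (d0 - d i).-homog,
    forall i, (d0 < d i)%N -> c i = 0 & p = \sum_(i | P i) c i * f i].
Proof.
move=> fd pd [c pE].
exists (fun i => if (d i <= d0)%N then pihomog mdeg (d0 - d i) (c i) else 0).
split=> [i -> | i|]; first exact: pihomogP; first by rewrite ltnNge => /negPf->.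
rewrite -(pihomog_dE pd) pE raddf_sum; apply: eq_bigr => i _ /=.
rewrite mulrC (pihomogMl _ _ (fd i)); case: ifP => _; first by rewrite mulrC.
by rewrite mul0r.
Qed.

Lemma in_ideal_avg P p : (forall i, invp (f i)) -> in_ideal P p ->
  in_ideal P (avg p).
Proof.
move=> jf [c ->]; exists (fun i => avg (c i)); rewrite avg_sum.
by apply: eq_bigr => i _; rewrite avgMr.
Qed.

End IdealOf.

(** Homogeneous generators of the Hilbert ideal, the ideal of the polynomial ring generated by the
    invariants vanishing at the origin. *)
Definition hilbert_gens (I : finType) (f : I -> {mpoly C[n]}) (d : I -> nat) :=
  [/\ forall i, invp (f i), forall i, f i \is (d i).-homog,
      forall i, (0 < d i)%N &
      forall p, invp p -> ev 0 p = 0 -> in_ideal f xpredT p].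

(* Each variable is integral over the invariants, so the ideal contains all
   monomials of large degree; the averages of the others generate it. *)
Lemma hilbert_gens_exist : exists (I : finType) f d, @hilbert_gens I f d.
Proof.
(* The orbit polynomial of ['X_j]: its lower coefficients are invariants without constant term. *)
pose P j : {poly {mpoly C[n]}} := \prod_(x in G) ('X - (act (rG x) 'X_j)%:P).
have sP j : size (P j) = #|G|.+1 by rewrite /P -big_enum size_prod_XsubC -cardE.
have mP j : P j \is monic by rewrite /P -big_enum monic_prod_XsubC.
have rP j : (P j).[ 'X_j ] = 0.
  rewrite horner_prod; apply/eqP/prodf_eq0; exists 1%g => //.
  by rewrite hornerXsubC repr_mx1 act1 subrr.
have iP j k : invp (P j)`_k.
  move=> y Gy; rewrite -coef_map; suff -> : map_poly (act (rG y)) (P j) = P j by [].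
  rewrite /P rmorph_prod /= [LHS](reindex_inj (mulgI y^-1%g)) /=.
  apply: eq_big => [x|x yx]; first by rewrite groupMl ?groupV.
  by rewrite rmorphB /= map_polyX map_polyC /= -act_repr ?mulKVg.
have zP j k : (k < #|G|)%N -> ev 0 (P j)`_k = 0.
  move=> kG; rewrite -coef_map /= rmorph_prod /=.
  rewrite (eq_bigr (fun=> 'X)) => [|x Gx]; last first.
    by rewrite rmorphB /= map_polyX map_polyC /= ev_act mul0mx evX mxE subr0.
  by rewrite prodr_const coefXn ltn_eqF.
pose b := \max_(j : 'I_n) \max_(k < #|G|) msize (P j)`_k.
(* All monomials of the lower coefficients of the [P j] have degree below [D], while a monomial of
   degree at least [D] has an exponent at least [#|G|]. *)
pose D := maxn b (n * #|G|).+1.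
(* The constant monomial is sent to [0], which is homogeneous of the positive degree [1] that [d]
   assigns to it. *)
pose f (m : 'X_{1..n < D}) := if m == 0%MM :> 'X_{1..n} then 0 else avg 'X_[m].
pose d (m : 'X_{1..n < D}) := maxn 1 (mdeg m).
have jf m : invp (f m).
  by rewrite /f; case: ifP => _; [exact: (invpC 0) | exact: avg_inv].
have avgJ m : m != 0%MM -> (mdeg m < D)%N -> in_ideal f xpredT (avg 'X_[m]).
  move=> m0 mD; have := @in_ideal_gen _ f xpredT (BMultinom mD) isT.
  by rewrite /f /= (negPf m0).
have supp0 p m : ev 0 p = 0 -> m \in msupp p -> m != 0%MM.
  by move=> p0; apply: contraTneq => ->; rewrite mcoeff_msupp -ev0E p0 eqxx.
have cJ j k : (k < #|G|)%N -> in_ideal f xpredT (P j)`_k.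
  move=> kG; rewrite -(avg_id (iP j k)) [(P j)`_k]mpolyE avg_sum big_seq.
  apply: in_ideal_sum => m mp; rewrite avgZ; apply/in_idealZ/avgJ.
    exact: supp0 (zP _ _ kG) mp.
  apply: leq_trans (msize_mdeg_lt mp) _; rewrite /D leq_max; apply/orP; left.
  apply: leq_trans (leq_bigmax j).
  exact: (leq_bigmax (F := fun k : 'I_#|G| => msize (P j)`_k) (Ordinal kG)).
have powJ j : in_ideal f xpredT ('X_j ^+ #|G|).
  have := rP j; rewrite horner_coef sP big_ord_recr /=.
  have -> : (P j)`_#|G| = 1.
    by have := monicP (mP j); rewrite lead_coefE sP.
  rewrite mul1r addrC => /eqP; rewrite addr_eq0 => /eqP ->.
  rewrite -mulN1r; apply: in_idealM; apply: in_ideal_sum => k _.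
  by rewrite mulrC; apply: in_idealM; apply: cJ.
have bigJ m : (D <= mdeg m)%N -> in_ideal f xpredT 'X_[m].
  move=> Dm; have [j jm] : exists j, (#|G| <= m j)%N.
    apply/existsP; apply: contraLR (leq_trans (leq_maxr _ _) Dm).
    rewrite negb_exists => /forallP H; rewrite -leqNgt mdegE.
    have -> : (n * #|G| = \sum_(i < n) #|G|)%N by rewrite sum_nat_const card_ord.
    by apply: leq_sum => i _; apply: ltnW; rewrite ltnNge.
  have -> : m = ((m - U_(j) *+ #|G|) + U_(j) *+ #|G|)%MM.
    rewrite submK //; apply/mnm_lepP => i; rewrite mulmnE mnm1E.
    by case: eqP => [<-|_]; rewrite ?mul1n.
  by rewrite mpolyXD -mpolyXn; apply: in_idealM.
exists 'X_{1..n < D}, f, d; split=> [//|m|m|p ip p0]; last 1 first.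
- rewrite -(avg_id ip) [p]mpolyE avg_sum big_seq.
  apply: in_ideal_sum => m mp; rewrite avgZ; apply/in_idealZ.
  have [mD|Dm] := ltnP (mdeg m) D; first by apply: avgJ => //; apply: supp0 mp.
  by apply: in_ideal_avg => //; apply: bigJ.
- rewrite /f /d; case: eqP => [_|/eqP m0]; first exact: rpred0.
  rewrite (maxn_idPr _) ?lt0n ?mdeg_eq0 //; apply: avg_homog.
  by rewrite dhomogX.
- by rewrite /d leq_max.
Qed.

End Invariants.

(** * Basic invariants of reflection groups *)

Section Chevalley.
Variables (C : numClosedFieldType) (gT : finGroupType) (G : {group gT}) (n : nat).
Variable rG : mx_representation C G n.

Definition irredundant (I : finType) (f : I -> {mpoly C[n]}) :=
  forall i, ~ in_ideal f (predC1 i) (f i).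

Lemma in_ideal_subset (I J : finType) (f : I -> {mpoly C[n]}) (P : pred I)
    (g : J -> {mpoly C[n]}) (Q : pred J) p :
  (forall i, P i -> in_ideal g Q (f i)) -> in_ideal f P p -> in_ideal g Q p.
Proof.
by move=> fg [c ->]; apply: in_ideal_sum => i Pi; apply/in_idealM/fg.
Qed.

Lemma minimal_gens_exist : exists m (f : 'I_m -> {mpoly C[n]}) d,
  hilbert_gens rG f d /\ irredundant f.
Proof.
have [I [f [d [jf fd d0 fJ]]]] := hilbert_gens_exist rG.
pose gen (S : {set I}) := `[< forall p, invp rG p -> ev 0 p = 0 -> in_ideal f (mem S) p >].
have gT' : gen setT.
  apply/asboolP => p ip p0; apply: in_ideal_subset (fJ p ip p0) => i _.
  by apply: in_ideal_gen; rewrite inE.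
case: (arg_minnP (fun S : {set I} => #|S|) gT') => S /asboolP genS minS.
pose e := @enum_val I (mem S); exists #|S|, (f \o e), (d \o e); split.
  split=> [i|i|i|p ip p0]; [exact: jf | exact: fd | exact: d0 |].
  apply: in_ideal_subset (genS p ip p0) => i iS.
  have -> : i = e (enum_rank_in iS i) by rewrite /e enum_rankK_in.
  exact: (@in_ideal_gen _ _ _ (f \o e)).
move=> i fi; have eiS : e i \in S by apply: enum_valP.
suff /minS : gen (S :\ e i) by rewrite leqNgt [X in (_ < X)%N](cardsD1 (e i)) eiS ltnS leqnn.
apply/asboolP => p ip p0; apply: in_ideal_subset (genS p ip p0) => j jS.
have [->|ji] := eqVneq j (e i).
  apply: in_ideal_subset fi => k ki; apply: in_ideal_gen.
  by rewrite !inE /= enum_valP andbT (inj_eq enum_val_inj).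
by apply: in_ideal_gen; rewrite !inE ji.
Qed.

(** Hilbert's argument: averaging [p = \sum_i c i * f i] makes the coefficients invariants of
    smaller degree, to which induction applies. *)
Lemma invariants_generated m (f : 'I_m -> {mpoly C[n]}) d : hilbert_gens rG f d ->
  forall p, invp rG p -> exists P, p = pcomp f P.
Proof.
case=> jf fd d0 fJ.
suff H k p : invp rG p -> p \is k.-homog -> exists P, p = pcomp f P.
  move=> p ip.
  have /choice[P PE] (k : 'I_(msize p)) : exists P, pihomog mdeg k p = pcomp f P.
    by apply: (H k); [exact: invp_pihomog | exact: pihomogP].
  exists (\sum_k P k); rewrite raddf_sum [LHS](pihomog_partitionE (leqnn (msize p))).
  by apply: eq_bigr => k _; rewrite PE.
have [b] := ubnP k; elim: b k p => // b IH k p; rewrite ltnS => kb ip pk.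
have [k0|k0] := posnP k.
  exists (ev 0 p)%:MP; rewrite pcompC -pihomog0_ev pihomog_dE //.
  by rewrite -[X in X.-homog]k0.
have p0 := homog_ev0 pk k0.
have [c [cd cd0 pE]] := in_ideal_homog fd pk (fJ p ip p0).
have /choice[P PE] i : exists P, avg rG (c i) = pcomp f P.
  have [dk|dk] := leqP (d i) k.
    apply: (IH (k - d i)%N); [have := d0 i; lia| exact: avg_inv | exact/avg_homog/cd].
  by exists 0; rewrite rmorph0 cd0 // avg_id //; apply: (invpC rG 0).
exists (\sum_i P i * 'X_i); rewrite -(avg_id ip) {1}pE avg_sum raddf_sum.
by apply: eq_bigr => i _; rewrite avgMr //= rmorphM /= pcompX PE.
Qed.

(** The shape to which [act_rank1] applies; reflections of any order have it, see
    [reflections_rank1]. *)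
Definition rank1_update (M : 'M[C]_n) :=
  exists2 l : 'cV[C]_n, l != 0 & exists b : 'rV[C]_n, M = 1%:M + l *m b.

Section Reflections.
Variable T : {set gT}.
Hypotheses (genT : <<T>>%g = G) (reflT : forall t, t \in T -> rank1_update (rG t)).

Lemma refl_subG : T \subset G.
Proof. by rewrite -genT subset_gen. Qed.

(** Induction on the degree of [p i1]. Divided differences by the elements of [T] satisfy the same
    relation in one degree less, so [p i1] is invariant modulo the Hilbert ideal, hence congruent to
    its average, which lies in that ideal. In degree zero, a nonzero constant would make [g i1]
    redundant. *)
Lemma chevalley_lemma (I K : finType) (f : I -> {mpoly C[n]}) d
    (g : K -> {mpoly C[n]}) (S : pred K) i1 : hilbert_gens rG f d ->
    (forall i, invp rG (g i)) -> S i1 ->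
    ~ in_ideal g [pred i | S i && (i != i1)] (g i1) ->
  forall k (p : K -> {mpoly C[n]}), p i1 \is k.-homog ->
    \sum_(i | S i) p i * g i = 0 -> in_ideal f xpredT (p i1).
Proof.
case=> jf fd d0 fJ jg Si1 ng; elim=> [|k IH] p pk rel.
  have pE : p i1 = (ev 0 (p i1))%:MP by rewrite -pihomog0_ev pihomog_dE.
  have [c0|c0] := eqVneq (ev 0 (p i1)) 0; first by rewrite pE c0; apply: in_ideal0.
  case: ng; exists (fun i => - (ev 0 (p i1))^-1 *: p i).
  move: rel; rewrite (bigD1 i1) //= {1}pE mul_mpolyC => /eqP.
  rewrite addr_eq0 => /eqP/(congr1 (fun q => (ev 0 (p i1))^-1 *: q)).
  rewrite scalerA mulVf // scale1r => ->; rewrite -sumrN scaler_sumr.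
  by apply: eq_bigr => i _; rewrite -scalerAl scalerN scaleNr.
have actJ x q : x \in G -> in_ideal f xpredT q -> in_ideal f xpredT (act (rG x) q).
  move=> Gx [c ->]; exists (fun i => act (rG x) (c i)).
  by rewrite raddf_sum; apply: eq_bigr => i _; rewrite /= rmorphM /= jf.
pose H := [set x in G | `[< in_ideal f xpredT (act (rG x) (p i1) - p i1) >]].
have gH : group_set H.
  apply/group_setP; split.
    rewrite inE group1; apply/asboolP; rewrite repr_mx1 act1 subrr.
    exact: in_ideal0.
  move=> x y; rewrite !inE => /andP[Gx /asboolP Hx] /andP[Gy /asboolP Hy].
  rewrite groupM //; apply/asboolP.
  have -> : act (rG (x * y)%g) (p i1) - p i1 =
     act (rG x) (act (rG y) (p i1) - p i1) + (act (rG x) (p i1) - p i1).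
    by rewrite rmorphB /= -act_repr // subrKA.
  by apply: in_idealD => //; apply: actJ.
have TH : T \subset Group gH.
  apply/subsetP => t Tt; have Gt := subsetP refl_subG _ Tt.
  rewrite inE Gt; apply/asboolP.
  have [l l0 [b tE]] := reflT Tt.
  have /choice[q qE] i : exists q, act (rG t) (p i) = p i + linp l * q.
    by rewrite tE; apply: act_rank1.
  have qrel : \sum_(i | S i) q i * g i = 0.
    have := congr1 (act (rG t)) rel; rewrite rmorph0 raddf_sum /=.
    rewrite (eq_bigr (fun i => p i * g i + linp l * (q i * g i))) => [|i _].
      rewrite big_split /= rel add0r -mulr_sumr => /eqP; rewrite mulf_eq0.
      by rewrite (negPf (linp_neq0 l0)) => /eqP.
    by rewrite rmorphM /= qE jg // mulrDl mulrA.
  have lq : linp l * q i1 \is k.+1.-homog.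
    have -> : linp l * q i1 = act (rG t) (p i1) - p i1 by rewrite qE addrC addKr.
    by rewrite rpredB // act_homog.
  have qk : q i1 \is k.-homog.
    have := pihomog_dE lq; rewrite (pihomogMl _ _ (linp_homog l)) /= subn1 /=.
    move/(mulfI (linp_neq0 l0)) => <-; exact: pihomogP.
  by rewrite qE addrC addKr; apply/in_idealM/(IH q).
have GH : G \subset Group gH by rewrite -genT gen_subG.
have dJ x : x \in G -> in_ideal f xpredT (act (rG x) (p i1) - p i1).
  by move=> Gx; have := subsetP GH _ Gx; rewrite inE => /andP[_ /asboolP].
have aJ : in_ideal f xpredT (avg rG (p i1)).
  apply: fJ; first exact: avg_inv.
  exact: homog_ev0 (avg_homog rG pk) _.
have -> : p i1 = avg rG (p i1) +
    (- (#|G|%:R^-1)) *: \sum_(x in G) (act (rG x) (p i1) - p i1).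
  rewrite scaleNr sumrB scalerBr opprB addrC -addrA addNr addr0.
  rewrite sumr_const -scaler_nat scalerA mulVf ?scale1r //.
  exact: card_neq0.
apply: in_idealD => //; apply: in_idealZ; apply: in_ideal_sum => x; exact: dJ.
Qed.

End Reflections.
End Chevalley.

(** * The Jacobian criterion for algebraic independence *)

Section Jacobian.
Variables (C : numClosedFieldType) (n : nat).

Definition jac m (f : 'I_m -> {mpoly C[n]}) : 'M[{mpoly C[n]}]_(m, n) :=
  \matrix_(i, k) (f i)^`M(k).

Definition jac_at m (f : 'I_m -> {mpoly C[n]}) (v : 'rV[C]_n) : 'M[C]_(m, n) :=
  \matrix_(i, k) ev v (f i)^`M(k).

Definition alg_indep m (f : 'I_m -> {mpoly C[n]}) :=
  forall P, pcomp f P = 0 -> P = 0.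

Lemma jac_atE m (f : 'I_m -> {mpoly C[n]}) v : jac_at f v = map_mx (ev v) (jac f).
Proof. by apply/matrixP => i k; rewrite !mxE. Qed.

(** Differentiating a relation [P] gives a syzygy of the Jacobian, so the derivatives of [P] are
    relations of smaller size, zero by induction; [P] is then constant. *)
Lemma alg_indep_jac m (f : 'I_m -> {mpoly C[n]}) :
    (forall g : 'rV_m, g *m jac f = 0 -> g = 0) -> alg_indep f.
Proof.
move=> fj P; have [k] := ubnP (msize P); elim: k P => // k IH P.
rewrite ltnS => sP fP.
have dP i : P^`M(i) = 0.
  have [//|dn0] := eqVneq (P^`M(i)) 0; apply: IH.
    exact: leq_trans (msize_mderiv dn0) sP.
  have /rowP/(_ i) : \row_j pcomp f P^`M(j) = 0.
    apply: fj; apply/rowP => l; rewrite !mxE.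
    have := mderiv_pcomp f l P; rewrite fP mderiv0 => e; rewrite [RHS]e.
    by apply: eq_bigr => j _; rewrite !mxE.
  by rewrite !mxE.
move: fP; rewrite [P](mderiv_eq0 dP) pcompC => /eqP.
by rewrite mpolyC_eq0 => /eqP->.
Qed.

Lemma alg_indep_jac_at (f : 'I_n -> {mpoly C[n]}) v :
  \det (jac_at f v) != 0 -> alg_indep f.
Proof.
rewrite jac_atE det_map_mx => dv; apply: alg_indep_jac => g gj.
apply/eqP; apply: contraNT dv => g0; apply/eqP.
suff /eqP-> : \det (jac f) == 0 by rewrite rmorph0.
by apply/det0P; exists g.
Qed.

End Jacobian.

(** Padding [A] with zero columns gives a square matrix of determinant zero, which over a domain has
    a kernel vector with entries in the ring. *)
Lemma wide_syzygy (R : idomainType) m n (A : 'M[R]_(m, n)) : (n < m)%N ->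
  exists2 g : 'rV_m, g != 0 & g *m A = 0.
Proof.
move=> nm; have : \det (A *m (pid_mx n : 'M_(n, m))) == 0.
  rewrite (expand_det_col _ (Ordinal nm)) big1 // => i _.
  rewrite mxE big1 ?mul0r // => k _; rewrite mxE /= ltn_eqF ?mulr0 //.
case/det0P => g g0; rewrite mulmxA => gA; exists g => //.
have := congr1 (mulmx^~ (pid_mx n : 'M_(m, n))) gA.
rewrite /= mul0mx -mulmxA mul_pid_mx !(minn_idPr _) ?minnn ?pid_mx_1 ?mulmx1 //.
exact: ltnW.
Qed.

Section ChevalleyJacobian.
Variables (C : numClosedFieldType) (gT : finGroupType) (G : {group gT}) (n : nat).
Variable rG : mx_representation C G n.

(** The gradients of invariants transform by the matrix of [x], so the new relation is a combination
    of transforms of the given ones. *)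
Lemma jac_relation_act m (f : 'I_m -> {mpoly C[n]}) (g : 'I_m -> {mpoly C[n]}) :
    (forall i, invp rG (f i)) ->
    (forall k, \sum_i g i * (f i)^`M(k) = 0) ->
  forall x, x \in G -> forall k, \sum_i act (rG x) (g i) * (f i)^`M(k) = 0.
Proof.
move=> jf rel x Gx k.
rewrite (eq_bigr (fun i => \sum_j rG x k j *: act (rG x) (g i * (f i)^`M(j)))).
  rewrite exchange_big big1 //= => j _.
  by rewrite -scaler_sumr -raddf_sum rel raddf0 scaler0.
move=> i _; rewrite -{1}(jf i x Gx) mderiv_act mulr_sumr.
by apply: eq_bigr => j _; rewrite rmorphM /= scalerAr.
Qed.

Variable T : {set gT}.
Hypotheses (genT : <<T>>%g = G) (reflT : forall t, t \in T -> rank1_update (rG t)).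

(* Chevalley's argument: in a relation with a minimal set S of generators of the
   ideal of the g i, the coefficient of a member of S lies in the Hilbert ideal,
   and Euler's formula then makes f i1 redundant. *)
Lemma jac_indep_homog m (f : 'I_m -> {mpoly C[n]}) d
    (g : 'I_m -> {mpoly C[n]}) D :
    hilbert_gens rG f d -> irredundant f ->
    (forall i, invp rG (g i)) ->
    (forall i, (d i <= D)%N -> g i \is (D - d i).-homog) ->
    (forall i, (D < d i)%N -> g i = 0) ->
    (forall k, \sum_i g i * (f i)^`M(k) = 0) ->
  forall i, g i = 0.
Proof.
move=> hf irr jg gd gd0 rel i0; have [jf fd d0 fJ] := hf.
pose gen (S : {set 'I_m}) := [forall j, `[< in_ideal g (mem S) (g j) >]].
have genT' : gen setT.
  by apply/forallP => j; apply/asboolP; apply: in_ideal_gen; rewrite inE.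
case: (arg_minnP (fun S : {set 'I_m} => #|S|) genT') => S genS minS.
have gS j : in_ideal g (mem S) (g j) by apply/asboolP/(forallP genS).
have [S0|[i1 Si1]] := set_0Vmem S.
  by have [c ->] := gS i0; rewrite big_pred0 // => i; rewrite S0 /= in_set0.
have ng : ~ in_ideal g [pred i | (i \in S) && (i != i1)] (g i1).
  move=> gi1; suff /minS : gen (S :\ i1).
    by rewrite leqNgt [X in (_ < X)%N](cardsD1 i1) Si1 ltnS leqnn.
  apply/forallP => j; apply/asboolP; apply: in_ideal_subset (gS j) => k kS.
  have [->|ki] := eqVneq k i1; last by apply: in_ideal_gen; rewrite !inE ki.
  apply: in_ideal_subset gi1 => l /andP[lS li].
  by apply: in_ideal_gen; rewrite !inE li.
have gi1 : g i1 != 0 by apply: contra_notN ng => /eqP->; apply: in_ideal0.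
have dD1 : (d i1 <= D)%N by rewrite leqNgt; apply: contraNN gi1 => /gd0->.
have gh i : g i \is (D - d i).-homog.
  by have [/gd//|/gd0->] := leqP (d i) D; rewrite rpred0.
have /choice[h hP] j : exists h : 'I_m -> {mpoly C[n]},
    g j = \sum_(i in S) h i * g i /\
    ((d j <= d i1)%N -> h i1 \is (d i1 - d j).-homog) /\
    ((d i1 < d j)%N -> h i1 = 0).
  have [dj|dj] := leqP (d j) D; last first.
    exists (fun=> 0); rewrite gd0 // big1 => [|i _]; last by rewrite mul0r.
    by rewrite rpred0.
  have [c [cd cd0 gE]] := in_ideal_homog (d := fun i => (D - d i)%N) gh (gh j) (gS j).
  exists c; split=> //; split=> H.
    have -> : (d i1 - d j = (D - d j) - (D - d i1))%N by lia.
    by apply: cd; lia.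
  by apply: cd0; lia.
(* The coefficient of [g i] once each [g j] with [j] outside [S] is expressed through the members of
   [S]. *)
pose p k i := (f i)^`M(k) + \sum_(j | j \notin S) h j i * (f j)^`M(k).
have pJ k : in_ideal f xpredT (p k i1).
  apply: (chevalley_lemma genT reflT hf jg Si1 ng (k := (d i1).-1)).
    rewrite rpredD ?homog_mderiv_pred // rpred_sum // => j jS.
    have [_ [h1 h0]] := hP j.
    have [dj|dj] := leqP (d j) (d i1); last by rewrite h0 // mul0r rpred0.
    have -> : ((d i1).-1 = (d i1 - d j) + (d j).-1)%N by have := d0 j; lia.
    by rewrite dhomogM ?h1 // homog_mderiv_pred.
  rewrite -[RHS](rel k) [in RHS](bigID (mem S)) /=.
  under [X in _ + X]eq_bigr => j _ do rewrite (hP j).1 mulr_suml.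
  rewrite exchange_big -big_split /=; apply: eq_bigr => i _.
  rewrite mulrDl mulr_suml mulrC; congr (_ + _); apply: eq_bigr => j _.
  by rewrite mulrAC.
have /choice[c cE] k : exists c : 'I_m -> _, p k i1 = \sum_i c i * f i.
  by have [c E] := pJ k; exists c.
(* Euler's formula identifies this with the sum of the ['X_k * p k i1], which lies in the Hilbert
   ideal. *)
pose Eu := (d i1)%:R *: f i1 + \sum_(j | j \notin S) (d j)%:R *: (h j i1 * f j).
have EuE : Eu = \sum_i (\sum_k 'X_k * c k i) * f i.
  rewrite (eq_bigr (fun i => \sum_k 'X_k * (c k i * f i))) => [|i _]; last first.
    by rewrite mulr_suml; apply: eq_bigr => k _; rewrite mulrA.
  rewrite exchange_big /= (eq_bigr (fun k => 'X_k * p k i1)) => [|k _]; last first.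
    by rewrite -mulr_sumr cE.
  rewrite /p; under eq_bigr => k _ do rewrite mulrDr mulr_sumr.
  rewrite big_split exchange_big /= (euler_homog (fd i1)); congr (_ + _).
  apply: eq_bigr => j _; rewrite scalerAr -(euler_homog (fd j)) mulr_sumr.
  by apply: eq_bigr => k _; rewrite mulrCA.
have Eud : Eu \is (d i1).-homog.
  rewrite rpredD ?rpredZ // rpred_sum // => j _; rewrite rpredZ //.
  have [_ [h1 h0]] := hP j.
  have [dj|dj] := leqP (d j) (d i1); last by rewrite h0 // mul0r rpred0.
  have -> : d i1 = (d i1 - d j + d j)%N by rewrite subnK.
  by rewrite dhomogM ?h1.
have EuI : in_ideal f (predC1 i1) Eu.
  rewrite -(pihomog_dE Eud) EuE raddf_sum /=; apply: in_ideal_sum => i _.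
  rewrite mulrC (pihomogMl _ _ (fd i)); case: ifP => _; last exact: in_ideal0.
  have [->|ii1] := eqVneq i i1; last by rewrite mulrC; apply/in_idealM/in_ideal_gen.
  (* In degree [d i1] the coefficient of [f i1] is the constant term of a combination of the
     variables, hence zero. *)
  rewrite subnn pihomog0_ev raddf_sum big1 ?mulr0 => [|k _].
    exact: in_ideal0.
  by rewrite /= rmorphM /= evX mxE mul0r.
case: (irr i1).
have -> : f i1 = (d i1)%:R^-1 *: (Eu -
    \sum_(j | j \notin S) (d j)%:R *: (h j i1 * f j)).
  by rewrite addrK scalerA mulVf ?scale1r // pnatr_eq0 -lt0n.
apply/in_idealZ; apply: in_idealD => //; rewrite -scaleN1r; apply: in_idealZ.
apply: in_ideal_sum => j jS; apply/in_idealZ/in_idealM/in_ideal_gen.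
by apply: contraNneq jS => /= ->.
Qed.

(* The syzygy is made invariant by multiplying by the other conjugates of one of
   its coefficients and averaging. *)
Lemma jac_indep m (f : 'I_m -> {mpoly C[n]}) d (g : 'I_m -> {mpoly C[n]}) :
    hilbert_gens rG f d -> irredundant f ->
    (forall k, \sum_i g i * (f i)^`M(k) = 0) ->
  forall i, g i = 0.
Proof.
move=> hf irr rel i0; have [jf fd d0 fJ] := hf.
have [//|gi0] := eqVneq (g i0) 0; exfalso.
pose Ng := \prod_(x in G | x != 1%g) act (rG x) (g i0).
pose g2 i := avg rG (Ng * g i).
have rel2 k : \sum_i g2 i * (f i)^`M(k) = 0.
  rewrite /g2 /avg; under eq_bigr => i _ do rewrite -scalerAl mulr_suml.
  rewrite -scaler_sumr exchange_big big1 ?scaler0 //= => x Gx.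
  apply: (jac_relation_act (g := fun i => Ng * g i)) => // {}k.
  by under eq_bigr => i _ do rewrite -mulrA; rewrite -mulr_sumr rel mulr0.
have NgE : Ng * g i0 = \prod_(x in G) act (rG x) (g i0).
  by rewrite [RHS](bigD1 1%g) //= repr_mx1 act1 mulrC.
have g20 : g2 i0 != 0.
  rewrite /g2 NgE avg_id.
    apply/prodf_neq0 => x Gx; apply: contraNneq gi0 => /(congr1 (act (rG x^-1%g))).
    by rewrite -act_repr ?groupV // mulVg repr_mx1 act1 rmorph0 => /eqP.
  move=> y Gy; rewrite rmorph_prod /= [LHS](reindex_inj (mulgI y^-1%g)) /=.
  apply: eq_big => [x|x yx]; first by rewrite groupMl ?groupV.
  by rewrite -act_repr ?mulKVg.
have [e ge0] : exists e, pihomog mdeg e (g2 i0) != 0.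
  apply/not_existsP => H; case/eqP: g20.
  rewrite (pihomog_partitionE (leqnn (msize (g2 i0)))) big1 // => e _.
  by apply/eqP; apply: contrapT => /negP/H.
(* The degree for which [g3 i0] is the component of degree [e] of [g2 i0], nonzero by choice of
   [e]. *)
pose D := (e + d i0)%N.
pose g3 i := if (d i <= D)%N then pihomog mdeg (D - d i) (g2 i) else 0.
suff : g3 i0 = 0 by apply/eqP; rewrite /g3 leq_addl addnK.
apply: (jac_indep_homog (D := D) hf irr) => [i|i dD|i dD|k].
- by rewrite /g3; case: ifP => _; [exact/invp_pihomog/avg_inv | exact: (invpC rG 0)].
- by rewrite /g3 dD; exact: pihomogP.
- by rewrite /g3 leqNgt dD.
have := congr1 (pihomog mdeg D.-1) (rel2 k); rewrite pihomog0 raddf_sum /= => H.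
rewrite -[RHS]H; apply: eq_bigr => i _.
rewrite [in RHS]mulrC (pihomogMl _ _ (homog_mderiv_pred k (fd i))) /g3.
have di := d0 i; have -> : ((d i).-1 <= D.-1)%N = (d i <= D)%N by rewrite /D; have := d0 i0; lia.
case: ifP => dD; last by rewrite mul0r.
by rewrite mulrC; congr (_ * pihomog _ _ _); lia.
Qed.

End ChevalleyJacobian.

(** * Quotient maps at points with small stabiliser *)

Section Generators.
Variables (C : numClosedFieldType) (gT : finGroupType) (G : {group gT}) (n : nat).
Variable rG : mx_representation C G n.

Definition generates m (f : 'I_m -> {mpoly C[n]}) :=
  forall p, invp rG p -> exists P, p = pcomp f P.

Definition free_at (v : 'rV[C]_n) :=
  forall x, x \in G -> v *m rG x = v -> x = 1%g.

End Generators.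

Section Etale.
Variables (C : numClosedFieldType) (gT : finGroupType) (G : {group gT}) (n : nat).
Variable rG : mx_representation C G n.

(* If the stabiliser of v lies in H, the quotient map V/H -> V/G is etale at v:
   invariants of G with prescribed differential at e(v) are obtained by
   averaging polynomials in e that vanish to second order at the other points
   of the orbit of e(v). *)
Lemma etale_jac_at k m (H : {group gT}) (nHG : (H <| G)%g)
    (e : 'I_k -> {mpoly C[n]}) (F : 'I_m -> {mpoly C[n]})
    (P : 'I_m -> {mpoly C[k]}) v :
    let rH := subg_repr rG (normal_sub nHG) in
    (forall i, invp rH (e i)) -> generates rH e -> alg_indep e ->
    (forall i, F i = pcomp e (P i)) -> generates rG F ->
    (forall x, x \in G -> v *m rG x = v -> x \in H) ->
  exists B, B *m jac_at P (\row_i ev v (e i)) = 1%:M.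
Proof.
move=> rH je ge ae FP gF stabH; set c := \row_i _.
have sHG := normal_sub nHG.
pose ce x : 'rV_k := \row_i ev (v *m rG x) (e i).
have evce x p : ev (v *m rG x) (pcomp e p) = ev (ce x) p by rewrite ev_pcomp.
have evc p : ev v (pcomp e p) = ev c p by rewrite ev_pcomp.
pose s := [seq ce x | x in [pred x | (x \in G) && (x \notin H)]].
have [q qc qs] : exists2 q, ev c q = 1 &
    forall w, w \in s -> ev w q = 0 /\ forall i, ev w q^`M(i) = 0.
  apply: separating_poly; apply/imageP => -[x]; rewrite inE => /andP[Gx nHx] cE.
  (* If [e(v x) = e(v)], then [v x] is in the [H]-orbit of [v], and [stabH] forces [x] into [H]. *)
  have [y Hy vy] : exists2 y, y \in H & v *m rG x = v *m rH y.
    apply: invariants_separate => p ip; have [Q ->] := ge p ip.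
    by rewrite evce evc cE.
  have Gy := subsetP sHG y Hy.
  case/negP: nHx; rewrite -(mulgKV y x) groupMr //.
  apply: stabH; rewrite ?groupM ?groupV //.
  rewrite repr_mxM ?groupV // mulmxA vy -mulmxA.
  by rewrite -[rH y]/(rG y) -repr_mxM ?groupV // mulgV repr_mx1 mulmx1.
(* At [c] this has the differential of ['X_j], while on [s] it vanishes to second order. *)
pose p j := ('X_j - (c 0 j)%:MP) * q.
have ppc j i : ev c (p j)^`M(i) = (j == i)%:R.
  rewrite mderivM rmorphD !rmorphM /= qc rmorphB /= evX evC subrr mul0r addr0.
  by rewrite mulr1 mderivB mderivC subr0 mderivXU rmorph_nat.
have pps j w i : w \in s -> ev w (p j)^`M(i) = 0.
  by case/qs => q0 dq0; rewrite mderivM rmorphD !rmorphM /= q0 dq0 !mulr0 addr0.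
have /choice[U UE] j : exists U,
    \sum_(x in G) act (rG x) (pcomp e (p j)) = pcomp F U.
  by apply: gF; exact: sum_act_inv.
(* Since [x] normalises [H], it preserves the [H]-invariants, which are the polynomials in [e]. *)
have /choice[t0 t0E] x : exists t : 'I_k -> {mpoly C[k]},
    x \in G -> forall i, act (rG x) (e i) = pcomp e (t i).
  have [Gx|] := boolP (x \in G); last by exists (fun=> 0).
  suff /choice[t tE] i : exists t, act (rG x) (e i) = pcomp e t by exists t.
  apply: ge => y Hy; have Gy := subsetP sHG y Hy.
  rewrite -[rH y]/(rG y) -act_repr // (conjgC y x) act_repr ?groupJ //.
  congr (act _ _); apply: (je i); rewrite memJ_norm //.
  exact: subsetP (normal_norm nHG) x Gx.
(* For [x] in [H] the choice is fixed to ['X_i], so that its derivatives are explicit. *)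
pose t x i := if x \in H then 'X_i else t0 x i.
have tE x i : x \in G -> act (rG x) (e i) = pcomp e (t x i).
  rewrite /t => Gx; case: ifP => Hx; last exact: t0E.
  by rewrite pcompX; apply: (je i).
have rel j : \sum_(x in G) pcomp (t x) (p j) = pcomp P (U j).
  apply/eqP; rewrite -subr_eq0; apply/eqP/ae; rewrite rmorphB raddf_sum /=.
  apply/eqP; rewrite subr_eq0; apply/eqP.
  rewrite pcomp_pcomp (eq_pcomp (g := F)) => [|i]; last by rewrite FP.
  rewrite -UE; apply: eq_bigr => x Gx; rewrite act.unlock !pcomp_pcomp.
  by apply: eq_pcomp => i; rewrite -tE // act.unlock.
have cE x : x \in G -> \row_i ev c (t x i) = ce x.
  by move=> Gx; apply/rowP => i; rewrite !mxE -evc -tE // ev_act.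
have cH x : x \in H -> ce x = c.
  move=> Hx; apply/rowP => i; rewrite !mxE -ev_act; congr (ev v _).
  exact: (je i).
(* Each [x] in [H] contributes an identity matrix and the other [x] contribute zero, whence the
   factor. *)
exists (#|H|%:R^-1 *: \matrix_(j, l) ev c (pcomp P (U j)^`M(l))).
apply/matrixP => j i; rewrite -scalemxAl !mxE.
have relj : \sum_l ev c (pcomp P (U j)^`M(l)) * ev c (P l)^`M(i) =
    ev c (\sum_(x in G) pcomp (t x) (p j))^`M(i).
  rewrite rel mderiv_pcomp raddf_sum; apply: eq_bigr => l _.
  by rewrite /= rmorphM.
under eq_bigr => l _ do rewrite !mxE.
rewrite relj (raddf_sum (mderiv i)) (raddf_sum (ev c)) /= (bigID (mem H)) /=.
rewrite [X in _ * (_ + X)]big1 => [|x /andP[Gx nHx]].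
  rewrite addr0 (eq_bigr (fun=> (j == i)%:R)) => [|x /andP[Gx Hx]].
    rewrite (eq_bigl (mem H)) => [|x]; last first.
      by rewrite andb_idl // => /(subsetP sHG).
    rewrite sumr_const -[X in _ * X]mulr_natl mulrA mulVf ?mul1r //.
    by rewrite pnatr_eq0 -lt0n cardG_gt0.
  rewrite mderiv_pcomp raddf_sum (bigD1 i) //= big1 => [|l li].
    rewrite rmorphM /= ev_pcomp cE // cH // ppc /t Hx mderivXU eqxx.
    by rewrite rmorph1 mulr1 addr0.
  by rewrite rmorphM /= /t Hx mderivXU (negPf li) rmorph0 mulr0.
rewrite mderiv_pcomp raddf_sum big1 // => l _.
rewrite /= rmorphM /= ev_pcomp cE // pps ?mul0r //.
by apply/imageP; exists x => //; rewrite inE Gx.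
Qed.

(** The case where [H] is trivial and [e] consists of the coordinates. *)
Lemma free_jac_at m (F : 'I_m -> {mpoly C[n]}) v : generates rG F ->
  free_at rG v -> exists B, B *m jac_at F v = 1%:M.
Proof.
move=> gF fv; have n1 : (1%G <| G)%g by exact: normal1.
have [B] : exists B, B *m jac_at F (\row_i ev v 'X_i) = 1%:M; last first.
  have -> : \row_i ev v 'X_i = v by apply/rowP => i; rewrite mxE evX.
  by exists B.
apply: (etale_jac_at (nHG := n1) (F := F)) => //.
- by move=> i x /set1P->; rewrite repr_mx1 act1.
- by move=> p _; exists p; rewrite pcomp_id.
- by move=> p; rewrite pcomp_id.
- by move=> i; rewrite pcomp_id.
- by move=> x Gx vx; rewrite (fv x) ?group1.
Qed.

(** By faithfulness the fixed spaces of the nontrivial elements are proper, and a generic vector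
    avoids them all. *)
Lemma faithful_free_at : mx_faithful rG -> exists v, free_at rG v.
Proof.
move=> fG; pose X x : 'M[C]_n := kermx (rG x - 1%:M).
have [x /andP[Gx x1]|v vP] :=
    @generic_vector C n _ [pred x | (x \in G) && (x != 1%g)] X.
  rewrite ltn_neqAle rank_leq_row andbT; apply: contraNneq x1 => rX.
  rewrite -in_set1; apply: (subsetP fG); rewrite inE Gx mul1mx /=.
  rewrite -subr_eq0 -mxrank_eq0 -(subKn (rank_leq_row _)) -mxrank_ker.
  by move: rX; rewrite /X => ->; rewrite subnn.
exists v => x Gx vx; apply/eqP; apply: contraT => x1.
have := vP x; rewrite /= Gx x1 => /(_ isT); rewrite sub_kermx.
by rewrite mulmxBr mulmx1 vx subrr eqxx.
Qed.

Definition basic_invariants (f : 'I_n -> {mpoly C[n]}) (d : 'I_n -> nat) :=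
  [/\ forall i, invp rG (f i), forall i, f i \is (d i).-homog,
      forall i, (0 < d i)%N, generates rG f & alg_indep f].

(** Minimal generators of the Hilbert ideal number exactly [n]: at a free point their Jacobian has
    rank [n], and more than [n] of them would have a syzygy excluded by [jac_indep]. Invertibility
    at that point then gives independence. *)
Theorem chevalley_basic_invariants (T : {set gT}) : mx_faithful rG ->
    <<T>>%g = G -> (forall t, t \in T -> rank1_update (rG t)) ->
  exists f d, basic_invariants f d.
Proof.
move=> fG genT reflT.
have [m [f [d [hf irr]]]] := minimal_gens_exist rG.
have gf : generates rG f := invariants_generated hf.
have [v fv] := faithful_free_at fG.
have [B Bj] := free_jac_at gf fv.
have nm : (n <= m)%N.
  by rewrite -(mxrank1 C n) -Bj; apply: leq_trans (mxrankM_maxr _ _) (rank_leq_row _).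
have mn : (m <= n)%N.
  rewrite leqNgt; apply/negP => /(wide_syzygy (jac f))[g g0 gj].
  case/eqP: g0; apply/rowP => i; rewrite [RHS]mxE.
  apply: (jac_indep genT reflT (g := g 0) hf irr) => k.
  have := congr1 (fun A : 'rV_n => A 0 k) gj; rewrite !mxE => e.
  by rewrite -[RHS]e; apply: eq_bigr => j _; rewrite mxE.
have mnE : m = n by apply/eqP; rewrite eqn_leq mn.
subst m; exists f, d; have [jf fd d0 _] := hf; split=> //.
apply: (@alg_indep_jac_at _ _ _ v).
by have [_] := mulmx1_unit Bj; rewrite unitmxE unitfE.
Qed.

Lemma basic_invariants_jac f d v : basic_invariants f d -> free_at rG v ->
  \det (jac_at f v) != 0.
Proof.
move=> [_ _ _ gf _] fv; have [B Bj] := free_jac_at gf fv.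
by have [_] := mulmx1_unit Bj; rewrite unitmxE unitfE.
Qed.

End Etale.

(** * Groups with polynomial invariants *)

Section ReflectionSet.
Variables (C : numClosedFieldType) (gT : finGroupType) (G : {group gT}) (n : nat).
Variable rG : mx_representation C G n.

(** The generating set in [is_reflection_group_repr], so that statements about it convert to that
    predicate. *)
Definition reflections : {set gT} :=
  [set x in G | (\rank (rfix_mx rG [set x])).+1 == n].

Lemma rank_rfix x : x \in G -> \rank (rfix_mx rG [set x]) = (n - \rank (rG x - 1%:M)%R)%N.
Proof.
move=> Gx; rewrite -mxrank_ker; apply: eqmx_rank; apply/andP; split.
  apply/sub_kermxP; rewrite mulmxBr mulmx1.
  have /rfix_mxP/(_ x (set11 x))-> := submx_refl (rfix_mx rG [set x]).
  by rewrite subrr.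
apply/rfix_mxP => _ /set1P->; apply/eqP; rewrite -subr_eq0 -[X in _ - X]mulmx1.
by rewrite -mulmxBr mulmx_ker.
Qed.

Lemma reflectionsP x :
  (x \in reflections) = (x \in G) && (\rank (rG x - 1%:M) == 1%N).
Proof.
rewrite inE; case Gx: (x \in G) => //=; rewrite rank_rfix //.
have := rank_leq_row (rG x - 1%:M); case: (\rank _) => [|r] rn; last by lia.
by rewrite subn0; apply/negbTE; lia.
Qed.

Lemma reflections_rank1 x : x \in reflections -> rank1_update (rG x).
Proof.
rewrite reflectionsP => /andP[Gx /eqP r1].
have := mulmx_base (rG x - 1%:M); move: (col_base _) (row_base _); rewrite r1.
move=> l b lb; exists l; last by exists b; rewrite lb addrC subrK.
by apply: contra_eq_neq r1 => l0; rewrite -lb l0 mul0mx mxrank0.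
Qed.

Lemma mxrank_conj_repr x y : x \in G -> y \in G ->
  \rank (rG (x ^ y)%g - 1%:M) = \rank (rG x - 1%:M).
Proof.
have le z w : z \in G -> w \in G ->
    (\rank (rG (z ^ w)%g - 1%:M)%R <= \rank (rG z - 1%:M)%R)%N.
  move=> Gz Gw; have -> : rG (z ^ w)%g - 1%:M = rG w^-1%g *m (rG z - 1%:M) *m rG w.
    rewrite mulmxBr mulmxBl mulmx1 -!repr_mxM ?groupM ?groupV // mulVg repr_mx1.
    by rewrite -mulgA.
  exact: leq_trans (mxrankM_maxl _ _) (mxrankM_maxr _ _).
move=> Gx Gy; apply/eqP; rewrite eqn_leq le //=.
by have := le (x ^ y)%g y^-1%g; rewrite conjgK groupJ ?groupV //; apply.
Qed.

Lemma reflections_normal : (<<reflections>> <| G)%g.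
Proof.
rewrite /normal gen_subG; apply/andP; split.
  by apply/subsetP => x; rewrite inE => /andP[].
apply: norms_gen; apply/subsetP => y Gy; rewrite inE; apply/subsetP => _ /imsetP[x Rx ->].
move: Rx; rewrite !reflectionsP => /andP[Gx r1].
by rewrite groupJ // mxrank_conj_repr.
Qed.

Lemma nontrivial_rank x : mx_faithful rG -> x \in G -> x != 1%g ->
  (0 < \rank (rG x - 1%:M)%R)%N.
Proof.
move=> fG Gx; apply: contraR; rewrite lt0n negbK mxrank_eq0 subr_eq0 => /eqP x1.
by rewrite -in_set1; apply: (subsetP fG); rewrite inE Gx mul1mx x1 eqxx.
Qed.

End ReflectionSet.

(** * Homogeneity of Jacobian determinants and of their factors *)

Section JacobianDegree.
Variables (C : numClosedFieldType) (n : nat).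

Lemma ev_det_jac m (P : 'I_m -> {mpoly C[m]}) c :
  ev c (\det (jac P)) = \det (jac_at P c).
Proof. by rewrite jac_atE det_map_mx. Qed.

Lemma det_jac_homog (F : 'I_n -> {mpoly C[n]}) d c v :
    (forall i, F i \is (d i).-homog) ->
  ev (c *: v) (\det (jac F)) = c ^+ (\sum_i (d i).-1) * ev v (\det (jac F)).
Proof.
move=> Fd; rewrite !ev_det_jac.
have -> : jac_at F (c *: v) = diag_mx (\row_i c ^+ (d i).-1) *m jac_at F v.
  rewrite mul_diag_mx; apply/matrixP => i k; rewrite !mxE.
  by rewrite (homog_ev _ _ (homog_mderiv_pred k (Fd i))).
rewrite det_mulmx det_diag; congr (_ * _); rewrite -prodrXr.
by apply: eq_bigr => i _; rewrite mxE.
Qed.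

Lemma jac_pcomp m (e : 'I_m -> {mpoly C[n]}) k (P : 'I_k -> {mpoly C[m]}) :
  jac (fun i => pcomp e (P i)) = map_mx (pcomp e) (jac P) *m jac e.
Proof.
apply/matrixP => i l; rewrite !mxE mderiv_pcomp.
by apply: eq_bigr => j _; rewrite !mxE.
Qed.

(* Stated without division: a - b, the degree of Q, may a priori be negative. *)
Lemma homog_factor (Q E F : {mpoly C[n]}) a b : E != 0 -> F = Q * E ->
    (forall c v, ev (c *: v) E = c ^+ b * ev v E) ->
    (forall c v, ev (c *: v) F = c ^+ a * ev v F) ->
  forall c v, c ^+ b * ev (c *: v) Q = c ^+ a * ev v Q.
Proof.
move=> E0 FE hE hF c v.
suff /(congr1 (ev v)) : (c ^+ b) *: act c%:M Q = (c ^+ a) *: Q.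
  by rewrite !evZ ev_act mul_mx_scalar.
apply: (mulIf E0); apply: ev_inj => {}v.
rewrite !rmorphM /= !evZ ev_act mul_mx_scalar.
have := hF c v; rewrite FE !rmorphM /= hE => H.
by rewrite -[RHS]mulrA -H; ring.
Qed.

(** Cancelling [c ^+ a], the polynomial [c ^+ (b - a) * Q(c v)] in [c] is the constant [Q(v)]. At
    [c = 0] this gives [Q(v) = Q(0)] if [a = b]; if [a < b] it forces [Q = 0]. *)
Lemma homog_factor_const (Q : {mpoly C[n]}) a b : (a <= b)%N ->
    (forall c v, c ^+ b * ev (c *: v) Q = c ^+ a * ev v Q) ->
  Q = (ev 0 Q)%:MP.
Proof.
move=> ab hQ; apply: ev_inj => v; rewrite evC.
have H : 'X^(b - a) * line 0 v Q = (ev v Q)%:P.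
  apply/eqP; rewrite -subr_eq0; apply/eqP/poly_eval0 => c c0.
  rewrite hornerD hornerN hornerC hornerM hornerXn horner_line add0r.
  apply: (mulfI (expf_neq0 a c0)); rewrite mulr0 mulrBr mulrA -exprD subnKC //.
  by rewrite hQ subrr.
have := congr1 (fun q => q.[0]) H; rewrite hornerC hornerM hornerXn horner_line.
rewrite scale0r addr0 expr0n; case: eqP => _; rewrite ?mul1r // mul0r => v0.
have := congr1 (fun q => q.[1]) H; rewrite -v0 hornerC hornerM hornerXn expr1n.
move: H; rewrite -v0 => /eqP; rewrite polyC0 mulf_eq0 -size_poly_eq0 size_polyXn /=.
by move=> /eqP/(congr1 (fun q => q.[0])); rewrite horner_line scale0r addr0 horner0.
Qed.

End JacobianDegree.

Section Converse.
Variables (C : numClosedFieldType) (gT : finGroupType) (G : {group gT}) (n : nat).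
Variable rG : mx_representation C G n.
Variables (F : 'I_n -> {mpoly C[n]}) (dF : 'I_n -> nat).
Hypotheses (fG : mx_faithful rG) (bF : basic_invariants rG F dF).

(* Up to products of invariants of smaller degree, F is an invertible linear
   combination of the e i, which allows an induction on the degree. *)
Lemma graded_inverse_function (e : 'I_n -> {mpoly C[n]}) (de : 'I_n -> nat)
    (P : 'I_n -> {mpoly C[n]}) :
    (forall i, e i \is (de i).-homog) -> (forall i, (0 < de i)%N) ->
    (forall i, F i = pcomp e (P i)) -> \det (jac_at P 0) != 0 ->
  forall j, exists U, e j = pcomp F U.
Proof.
move=> ed de0 FP dP; pose S p := exists U, p = pcomp F U.
have Fd : forall i, F i \is (dF i).-homog by case: bF.
have SC c : S c%:MP by exists c%:MP; rewrite pcompC.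
have SD p q : S p -> S q -> S (p + q).
  by move=> [U ->] [V ->]; exists (U + V); rewrite rmorphD.
have SM p q : S p -> S q -> S (p * q).
  by move=> [U ->] [V ->]; exists (U * V); rewrite rmorphM.
have SZ c p : S p -> S (c *: p) by rewrite -mul_mpolyC; apply: SM; exact: SC.
have S0 : S 0 by exact: (SC 0).
have Ssum I (r : seq I) (A : pred I) f : (forall i, A i -> S (f i)) ->
    S (\sum_(i <- r | A i) f i) by apply: big_ind.
move=> j; have [b] := ubnP (de j); elim: b j => // b IH j; rewrite ltnS => jb.
pose E k := pihomog mdeg (de j) (e k).
have SF i : S (pihomog mdeg (de j) (F i)).
  have [<-|ne] := eqVneq (dF i) (de j).
    by rewrite pihomog_dE //; exists 'X_i; rewrite pcompX.
  by rewrite (pihomog_homog_neq (Fd i)).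
pose M := jac_at P 0.
have ME i k : M i k = (P i)@_U_(k).
  by rewrite mxE ev0E mcoeff_deriv add0m mnm0E mulr1n.
(* As all weights are positive, a monomial of weight [de j] and degree other than one involves only
   variables of weight below [de j], covered by induction. *)
have mon m : (mdeg m != 1)%N -> S (pihomog mdeg (de j) (pcomp e 'X_[m])).
  move=> m1; have hm := pcomp_dhomog_mnm m ed.
  have [wE|ne] := eqVneq (\sum_i de i * m i)%N (de j); last first.
    by rewrite (pihomog_homog_neq hm).
  rewrite pihomog_dE -?wE // mpolyXE_id rmorph_prod /=.
  apply: (big_ind S) => [||i _]; [exact: (SC 1) | exact: SM |].
  rewrite rmorphXn /= pcompX.
  have [->|mi0] := eqVneq (m i) 0%N; first by rewrite expr0; exact: (SC 1).
  have ltij : (de i < de j)%N.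
    rewrite -wE (bigD1 i) //=.
    have [mi1|mi1] := eqVneq (m i) 1%N; last first.
      apply: leq_trans (leq_addr _ _).
      by rewrite -{1}[de i]muln1 ltn_pmul2l ?de0 // ltn_neqAle eq_sym mi1 lt0n.
    rewrite mi1 muln1 -{1}[de i]addn0 ltn_add2l lt0n.
    apply: contraNneq m1 => /eqP; rewrite sum_nat_eq0 => /forallP H.
    rewrite mdegE (bigD1 i) //= mi1 big1 // => k ki.
    by have := H k; rewrite ki /= muln_eq0 gtn_eqF ?de0 //= => /eqP.
  elim: (m i) => [|k IHk]; first by rewrite expr0; exact: (SC 1).
  by rewrite exprS; apply: SM => //; apply: IH; apply: leq_trans ltij jb.
have ST p : S (pihomog mdeg (de j) (pcomp e p) - \sum_k p@_U_(k) *: E k).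
  elim/mpolyind: p => [|c m p _ _ IHp].
    rewrite rmorph0 pihomog0 big1 ?subr0 // => k _.
    by rewrite mcoeff0 scale0r.
  rewrite rmorphD /= pihomogD pcompZ linearZ /=.
  under eq_bigr => k _ do rewrite mcoeffD mcoeffZ scalerDl -scalerA.
  rewrite big_split /= -scaler_sumr opprD addrACA -scalerBr.
  apply: SD => //; apply: SZ.
  have [/eqP/mdeg1P[i /eqP->]|m1] := eqVneq (mdeg m) 1%N.
    rewrite pcompX (bigD1 i) //= mcoeffX eqxx scale1r big1 ?addr0 ?subrr // => k.
    by rewrite mcoeffX eq_mnm1 eq_sym => /negPf->; rewrite scale0r.
  rewrite big1 ?subr0 => [|k _]; first exact: mon.
  rewrite mcoeffX; case: eqP => [mE|_]; last by rewrite scale0r.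
  by rewrite mE mdeg1 in m1.
have SG i : S (\sum_k M i k *: E k).
  have -> : \sum_k M i k *: E k = pihomog mdeg (de j) (F i) +
      (-1) *: (pihomog mdeg (de j) (pcomp e (P i)) - \sum_k (P i)@_U_(k) *: E k).
    rewrite scaleN1r opprB FP addrC subrK.
    by apply: eq_bigr => k _; rewrite ME.
  exact: SD (SF i) (SZ _ _ (ST _)).
have uM : M \in unitmx by rewrite unitmxE unitfE.
suff -> : e j = \sum_i invmx M j i *: \sum_k M i k *: E k.
  by apply: Ssum => i _; apply: SZ.
under eq_bigr => i _ do rewrite scaler_sumr.
rewrite exchange_big (bigD1 j) //= [X in _ + X]big1 => [|k kj].
  under eq_bigr => i _ do rewrite scalerA.
  have := mulVmx uM => /matrixP/(_ j j); rewrite !mxE eqxx => H.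
  by rewrite -scaler_suml H scale1r addr0 /E pihomog_dE.
under eq_bigr => i _ do rewrite scalerA.
have := mulVmx uM => /matrixP/(_ j k); rewrite !mxE eq_sym (negPf kj) => H.
by rewrite -scaler_suml H scale0r.
Qed.

Theorem generated_by_reflections : <<reflections rG>>%g = G.
Proof.
have [jF Fd d0 gF aF] := bF.
pose H := <<reflections rG>>%G.
have nHG : (H <| G)%g := reflections_normal rG.
have sHG := normal_sub nHG; pose rH := subg_repr rG sHG.
have fH : mx_faithful rH.
  by rewrite /mx_faithful rker_subg; apply: subset_trans (subsetIr _ _) fG.
have reflH t : t \in reflections rG -> rank1_update (rH t).
  exact: reflections_rank1.
have [e [de be]] := chevalley_basic_invariants fH (erefl _) reflH.
have [je ed de0 ge ae] := be.
have /choice[P FP] i : exists P, F i = pcomp e P.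
  by apply: ge => x Hx; apply: (jF i); apply: (subsetP sHG).
have [v0 fv0] := faithful_free_at fG.
have fv0H : free_at rH v0 by move=> x Hx; apply: fv0; apply: (subsetP sHG).
pose DF := \det (jac F); pose De := \det (jac e).
have DF0 : DF != 0.
  apply: contraNneq (basic_invariants_jac bF fv0) => DF0.
  by rewrite -ev_det_jac -/DF DF0 rmorph0.
have De0 : De != 0.
  apply: contraNneq (basic_invariants_jac be fv0H) => De0.
  by rewrite -ev_det_jac -/De De0 rmorph0.
pose Q := pcomp e (\det (jac P)).
have DFE : DF = Q * De.
  rewrite /DF /Q -det_map_mx -det_mulmx -jac_pcomp; congr (\det _).
  by apply/matrixP => i k; rewrite !mxE FP.
have evQ v : ev v Q = \det (jac_at P (\row_i ev v (e i))).
  by rewrite ev_pcomp ev_det_jac.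
have hQ := homog_factor De0 DFE (fun c v => det_jac_homog c v ed)
  (fun c v => det_jac_homog c v Fd).
have e0 : \row_i ev 0 (e i) = 0.
  by apply/rowP => i; rewrite !mxE (homog_ev0 (ed i)).
have [->//|nHG'] := eqVneq <<reflections rG>>%g (G : {set gT}).
have Q0 : ev 0 Q != 0.
  apply/eqP => Q0; have [le_s|lt_s] := leqP (\sum_i (dF i).-1) (\sum_i (de i).-1).
    case/eqP: DF0; rewrite DFE (homog_factor_const le_s hQ) Q0.
    by rewrite mpolyC0 mul0r.
  have hQ' c v : c != 0 -> ev (c *: v) Q =
      c ^+ (\sum_i (dF i).-1 - \sum_i (de i).-1) * ev v Q.
    move=> c0; apply: (mulfI (expf_neq0 (\sum_i (de i).-1) c0)).
    by rewrite hQ mulrA -exprD subnKC // ltnW.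
  have [|x /andP[Gx nHx]|v Qv vP] := zero_off_codim2
    (P := [pred x | (x \in G) && (x \notin H)])
    (X := fun x => kermx (rG x - 1%:M)) _ hQ'; first by rewrite subn_gt0.
    have x1 : x != 1%g by apply: contraNneq nHx => ->; exact: group1.
    have := nontrivial_rank fG Gx x1.
    have : \rank (rG x - 1%:M) != 1%N.
      apply: contraNneq nHx => r1; apply: mem_gen.
      by rewrite reflectionsP Gx r1 eqxx.
    have := rank_leq_row (rG x - 1%:M).
    by rewrite mxrank_ker; case: (\rank _) => [|[|r]] //; lia.
  (* No element outside [H] fixes [v], so the Jacobian of [P] is invertible at [e(v)], against
     [Qv]. *)
  have [x Gx vx|B BP] := etale_jac_at (nHG := nHG) je ge ae FP gF (v := v).
    apply: contraT => nHx; have := vP x; rewrite /= Gx nHx => /(_ isT).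
    by rewrite sub_kermx mulmxBr mulmx1 vx subrr eqxx.
  have [_] := mulmx1_unit BP; rewrite unitmxE unitfE -evQ Qv eqxx //.
have dP0 : \det (jac_at P 0) != 0 by move: Q0; rewrite evQ e0.
have eF := graded_inverse_function ed de0 FP dP0.
have jeG i : invp rG (e i).
  by have [U ->] := eF i; apply: invp_pcomp.
apply/eqP; rewrite eqEsubset sHG; apply/subsetP => x Gx.
(* The [e i] are now known to be [G]-invariant, so no [H]-invariant separates [v0] from its
   [G]-translates; freeness of [v0] then gives [x = y]. *)
have [y Hy vy] : exists2 y, y \in H & v0 *m rG x = v0 *m rH y.
  apply: invariants_separate => p ip; have [U ->] := ge p ip.
  by rewrite -ev_act; congr (ev _ _); apply/esym; apply: (invp_pcomp (rG := rG)).
have Gy := subsetP sHG y Hy.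
suff -> : x = y by [].
apply: (mulIg y^-1%g); rewrite mulgV; apply: fv0; rewrite ?groupM ?groupV //.
rewrite repr_mxM ?groupV // mulmxA vy -mulmxA.
by rewrite -[rH y]/(rG y) -repr_mxM ?groupV // mulgV repr_mx1 mulmx1.
Qed.

End Converse.

(** * Stabilisers of regular vectors *)

Section RankOne.
Variables (C : numClosedFieldType) (n : nat).

Lemma forms_proportional (l l' : 'cV[C]_n) : l != 0 ->
  (forall v : 'rV_n, v *m l = 0 -> v *m l' = 0) -> exists a, l' = a *: l.
Proof.
move=> /col_form_neq0[b bl] H; exists ((b *m l') 0 0).
have E : (1%:M - l *m b) *m l' = 0.
  apply/row_matrixP => i; rewrite row_mul row0; apply: H.
  by rewrite -row_mul mulmxBl mul1mx -mulmxA bl mulmx1 subrr row0.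
move/eqP: E; rewrite mulmxBl mul1mx subr_eq0 -mulmxA => /eqP e; rewrite [LHS]e.
by rewrite [X in l *m X]mx11_scalar mul_mx_scalar.
Qed.

(** Two block triangular factorisations of the same matrix are compared. *)
Lemma det_rank1_update (l : 'cV[C]_n) (b : 'rV[C]_n) :
  \det (1%:M + l *m b) = 1 + (b *m l) 0 0.
Proof.
have E1 : block_mx 1%:M (- b) l 1%:M =
    block_mx 1%:M 0 l 1%:M *m block_mx 1%:M (- b) 0 (1%:M + l *m b).
  by rewrite mulmx_block !mul1mx !mul0mx !mulmx1 ?mulmx0 !addr0 mulmxN [_ + (1%:M + _)]addrC addrK.
have E2 : block_mx 1%:M (- b) l 1%:M =
    block_mx (1%:M + b *m l) (- b) 0 1%:M *m block_mx 1%:M 0 l 1%:M.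
  by rewrite mulmx_block !mulmx1 !mul0mx !mul1mx ?mulmx0 !add0r mulNmx addrK.
have := congr1 determinant E1; rewrite {1}E2 !det_mulmx !det_ublock !det_lblock.
by rewrite !det1 !mul1r !mulr1 [1%:M + b *m l]mx11_scalar det_scalar1 !mxE eqxx.
Qed.

End RankOne.

(** * Groups generated by a conjugation-stable set of reflections, one per hyperplane *)

Section Regular.
Variables (C : numClosedFieldType) (gT : finGroupType) (G : {group gT}) (n : nat).
Variable rG : mx_representation C G n.
Variable T : {set gT}.
Hypotheses (fG : mx_faithful rG) (genT : <<T>>%g = G) (normT : G \subset 'N(T)%g).
Hypothesis rankT : forall t, t \in T -> \rank (rG t - 1%:M) = 1%N.
Hypothesis sepT : forall t t', t \in T -> t' \in T ->
  (forall v : 'rV_n, v *m rG t = v -> v *m rG t' = v) -> t = t'.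

Let TG : T \subset G. Proof. by rewrite -genT subset_gen. Qed.

Lemma reflection_form x : x \in G -> \rank (rG x - 1%:M) = 1%N ->
  exists2 l : 'cV[C]_n, l != 0 & (forall v : 'rV_n, v *m rG x = v <-> v *m l = 0) /\
    exists2 b : 'rV[C]_n, b != 0 & rG x = 1%:M + l *m b.
Proof.
move=> Gx r1; have Rx : x \in reflections rG by rewrite reflectionsP Gx r1.
have [l l0 [b xE]] := reflections_rank1 Rx.
have b0 : b != 0.
  by apply: contra_eq_neq r1 => b0; rewrite xE b0 mulmx0 addr0 subrr mxrank0.
exists l => //; split; last by exists b.
move=> v; rewrite xE mulmxDr mulmx1 mulmxA; split=> [/eqP|->]; last first.
  by rewrite mul0mx addr0.
rewrite -subr_eq0 addrC addKr [v *m l]mx11_scalar mul_scalar_mx scaler_eq0.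
by rewrite (negPf b0) orbF => /eqP->; rewrite raddf0.
Qed.

Lemma regular_forms : exists l : gT -> 'cV[C]_n, forall t, t \in T ->
  l t != 0 /\ (forall v : 'rV_n, v *m rG t = v <-> v *m l t = 0).
Proof.
have /choice[l lP] t : exists l : 'cV[C]_n, t \in T ->
    l != 0 /\ (forall v : 'rV_n, v *m rG t = v <-> v *m l = 0).
  have [Tt|] := boolP (t \in T); last by exists 0.
  have [l l0 [lE _]] := reflection_form (subsetP TG t Tt) (rankT Tt).
  by exists l.
by exists l.
Qed.

(** The rows of [kermx l] span the hyperplane, so the pullbacks of the forms are nonzero and
    [generic_point] applies to them. *)
Lemma nonvanishing_on_hyperplane (P : pred gT) (l : 'cV[C]_n) (f : gT -> 'cV[C]_n) :
  (forall t, P t -> exists2 v : 'rV_n, v *m l = 0 & v *m f t != 0) ->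
  exists2 v : 'rV_n, v *m l = 0 & ev v (\prod_(t | P t) linp (f t)) != 0.
Proof.
move=> H; have [t Pt|w wP] := @generic_point C n _ P (fun t => act (kermx l) (linp (f t))).
  have [v /sub_kermxP/submxP[a vE] vf] := H t Pt.
  apply: contraNneq vf => /(congr1 (ev a)); rewrite ev_act -vE ev_linp rmorph0.
  by move=> e; apply/eqP/matrixP => i j; rewrite !ord1 e mxE.
exists (w *m kermx l); first by rewrite -mulmxA mulmx_ker mulmx0.
rewrite rmorph_prod; apply/prodf_neq0 => t Pt /=.
by rewrite -ev_act wP.
Qed.

(* The product of the linear forms of the hyperplanes of T transforms by the
   determinant under T, hence under G; a reflection whose hyperplane is not
   among these fixes it, hence has determinant 1. *)
Lemma reflection_hyperplanes x : x \in G -> \rank (rG x - 1%:M) = 1%N ->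
  exists2 t, t \in T & forall v : 'rV_n, v *m rG x = v -> v *m rG t = v.
Proof.
move=> Gx rx; have [l lP] := regular_forms.
have [lx lx0 [lxP [bx bx0 xE]]] := reflection_form Gx rx.
apply: contrapT => nT.
pose L := \prod_(t in T) linp (l t).
have L0 : L != 0 by apply/prodf_neq0 => t Tt; apply: linp_neq0 (lP t Tt).1.
(* Conjugation by [y] permutes [T], hence its hyperplanes, so the forms are permuted up to
   scalars. *)
have semi y : y \in G -> exists c, act (rG y) L = c *: L.
  move=> Gy; have /choice[a aP] t : exists a, t \in T ->
      act (rG y) (linp (l t)) = a *: linp (l (t ^ y^-1)%g).
    have [Tt|] := boolP (t \in T); last by exists 0.
    have Tt' : (t ^ y^-1)%g \in T by rewrite memJ_norm ?groupV ?(subsetP normT).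
    have [a aE] : exists a, rG y *m l t = a *: l (t ^ y^-1)%g.
      apply: forms_proportional; first exact: (lP _ Tt').1.
      have yt : (y * t = t ^ y^-1 * y)%g.
        by rewrite conjgE invgK -!mulgA mulVg mulg1.
      move=> v /((lP _ Tt').2 v) e; rewrite mulmxA; apply/((lP _ Tt).2 _).
      rewrite -mulmxA -repr_mxM ?(subsetP TG t Tt) // yt.
      by rewrite repr_mxM ?(subsetP TG _ Tt') // mulmxA e.
    exists a => _; apply: ev_inj => v.
    by rewrite ev_act ev_linp evZ ev_linp -mulmxA aE -scalemxAr mxE.
  exists (\prod_(t in T) a t); rewrite /L rmorph_prod /=.
  rewrite (eq_bigr (fun t => (a t)%:MP * linp (l (t ^ y^-1)%g))) => [|t Tt].
    rewrite big_split /= -mul_mpolyC rmorph_prod; congr (_ * _).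
    rewrite [RHS](reindex_inj (conjg_inj y^-1%g)) /=; apply: eq_bigl => t.
    by rewrite memJ_norm ?groupV ?(subsetP normT).
  by rewrite aP // mul_mpolyC.
have detT : forall y, y \in G -> act (rG y) L = \det (rG y) *: L.
  pose H := [set y in G | act (rG y) L == \det (rG y) *: L].
  have gH : group_set H.
    apply/group_setP; split; first by rewrite inE group1 repr_mx1 act1 det1 scale1r /=.
    move=> y z; rewrite !inE => /andP[Gy /eqP Hy] /andP[Gz /eqP Hz].
    by rewrite groupM // act_repr // Hz actZ Hy repr_mxM // det_mulmx scalerA mulrC eqxx.
  suff TH : T \subset Group gH.
    move=> y Gy; have : y \in Group gH.
      by apply: (subsetP _ y Gy); rewrite -genT gen_subG.
    by rewrite inE => /andP[_ /eqP].
  apply/subsetP => t Tt; have Gt := subsetP TG t Tt; rewrite inE Gt /=.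
  have [c cE] := semi t Gt; rewrite cE; apply/eqP; congr (_ *: _).
  have [lt lt0 [ltP [bt bt0 tE]]] := reflection_form Gt (rankT Tt).
  have [a aE] : exists a, l t = a *: lt.
    by apply: forms_proportional => // v /ltP/((lP t Tt).2).
  have tl : rG t *m l t = \det (rG t) *: l t.
    rewrite tE det_rank1_update aE mulmxDl mul1mx scalerDl scale1r; congr (_ + _).
    rewrite -scalemxAr -mulmxA [X in lt *m X]mx11_scalar mul_mx_scalar !scalerA.
    by rewrite mulrC.
  (* By [sepT] some [v] on the hyperplane of [t] is on no other one. Since [t] fixes [v], the other
     factors keep their value there, and the scalar is the one on [l t], namely [\det (rG t)]. *)
  have [t' /andP[Tt' tt']|v vl vL] :=
      @nonvanishing_on_hyperplane [pred t' | (t' \in T) && (t' != t)] (l t) l.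
    apply: contrapT => nv; case/eqP: tt'; apply/esym/sepT => // v /((lP t Tt).2) vt.
    apply/((lP t' Tt').2); apply/eqP; apply: contraT => vt'.
    by case: nv; exists v.
  move: cE; rewrite /L (bigD1 t) //= rmorphM /=.
  have -> : act (rG t) (linp (l t)) = \det (rG t) *: linp (l t).
    by apply: ev_inj => w; rewrite ev_act ev_linp evZ ev_linp -mulmxA tl -scalemxAr mxE.
  rewrite -scalerAl !scalerAr => /(mulfI (linp_neq0 (lP t Tt).1)).
  move/(congr1 (ev v)); rewrite !evZ ev_act.
  have -> : v *m rG t = v by apply/((lP t Tt).2).
  by move/(mulIf vL) => ->.
have [t Tt|v vl vL] := @nonvanishing_on_hyperplane (mem T) lx l.
  apply: contrapT => nv; case: nT; exists t => // v /lxP vx.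
  apply/((lP t Tt).2); apply/eqP; apply: contraT => vt.
  by case: nv; exists v.
have detx : \det (rG x) = 1.
  have := congr1 (ev v) (detT x Gx); rewrite ev_act evZ.
  have -> : v *m rG x = v by apply/lxP.
  by move=> e; apply: (mulIf vL); rewrite mul1r -/L -e.
(* Determinant one makes [x] a transvection, whose powers [1 + k lx bx] never return to the identity
   in characteristic zero, contrary to its finite order. *)
have bl : bx *m lx = 0.
  move: detx; rewrite xE det_rank1_update => /eqP; rewrite -subr_eq0 addrC addKr => /eqP e.
  by apply/matrixP => i j; rewrite !ord1 e mxE.
have pw k : rG (x ^+ k)%g = 1%:M + k%:R *: (lx *m bx).
  elim: k => [|k IH]; first by rewrite expg0 repr_mx1 scale0r addr0.
  rewrite expgSr repr_mxM ?groupX // IH xE mulmxDl mul1mx -scalemxAl mulmxDr mulmx1.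
  by rewrite mulmxA -[lx *m bx *m lx]mulmxA bl mulmx0 mul0mx addr0 addrAC -addrA -natr1 scalerDl scale1r addrC.
have := pw #[x]%g; rewrite expg_order repr_mx1 => /eqP.
rewrite -subr_eq0 opprD addNKr oppr_eq0 scaler_eq0 pnatr_eq0 gtn_eqF ?order_gt0 //=.
by move=> /eqP lb; move: rx; rewrite xE lb addr0 subrr mxrank0.
Qed.

Lemma jac_at_repr m (f : 'I_m -> {mpoly C[n]}) v x : (forall i, invp rG (f i)) ->
  x \in G -> jac_at f v = jac_at f (v *m rG x) *m (rG x)^T.
Proof.
move=> jf Gx; apply/matrixP => i k; rewrite !mxE -[in LHS](jf i x Gx) mderiv_act.
rewrite raddf_sum; apply: eq_bigr => j _.
by rewrite /= !mxE evZ ev_act mulrC.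
Qed.

Lemma strip_forms (J : {mpoly C[n]}) (l : gT -> 'cV[C]_n) : J != 0 ->
    (forall t, t \in T -> l t != 0) ->
  exists Q k, J = Q * \prod_(t in T) linp (l t) ^+ k t /\
    forall t, t \in T -> ~ exists q, Q = linp (l t) * q.
Proof.
move=> J0 l0; have [b] := ubnP (msize J); elim: b J J0 => // b IH J J0.
rewrite ltnS => Jb.
have [[t Tt [q JE]]|H] := pselect (exists2 t, t \in T & exists q, J = linp (l t) * q).
  have q0 : q != 0 by apply: contraNneq J0 => q0; rewrite JE q0 mulr0.
  have lt0 := linp_neq0 (l0 t Tt).
  have s2 : msize (linp (l t)) = 2.
    have := dhomog_msize (linp_homog (l t)).
    by move/(dhomog_uniq lt0 (linp_homog (l t))); rewrite mpolySpred //= => <-.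
  have qb : (msize q < b)%N by apply: leq_trans Jb; rewrite JE msizeM // s2.
  have [Q [k [qE kP]]] := IH q q0 qb.
  exists Q, (fun t' => k t' + (t' == t))%N; split=> //.
  rewrite JE qE mulrCA; congr (_ * _).
  under [RHS]eq_bigr => t' _ do rewrite exprD.
  rewrite big_split mulrC; congr (_ * _); rewrite (bigD1 t) //= eqxx expr1.
  by rewrite big1 ?mulr1 // => t' /andP[_ /negPf->].
exists J, (fun=> 0%N); split=> [|t Tt tJ]; last by apply: H; exists t.
by rewrite big1 ?mulr1.
Qed.

(* On a generic plane through a point with trivial stabiliser, the Jacobian of
   the basic invariants, once its factors at the hyperplanes of T are removed,
   has no zero: a zero has a nontrivial stabiliser, so it lies on one of these
   hyperplanes.  What remains is therefore a constant. *)
Theorem regular_free (p : 'rV[C]_n) :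
  (forall t, t \in T -> p *m rG t != p) -> free_at rG p.
Proof.
move=> pT; have [l lP] := regular_forms.
have reflT t : t \in T -> rank1_update (rG t).
  move=> Tt; apply: reflections_rank1.
  by rewrite reflectionsP (subsetP TG) ?rankT.
have [f [d bf]] := chevalley_basic_invariants fG genT reflT.
have [jf fd d0 gf af] := bf.
have [p0 fp0] := faithful_free_at fG.
pose J := \det (jac f).
have J_free v : free_at rG v -> ev v J != 0.
  by move=> fv; rewrite ev_det_jac; apply: (basic_invariants_jac bf).
have J0 : J != 0 by apply: contraNneq (J_free p0 fp0) => ->; rewrite rmorph0.
have [Q [k [JE kP]]] := strip_forms J0 (fun t Tt => (lP t Tt).1).
set L := \prod_(t in T) _ in JE.
have L0 : L != 0.
  by apply/prodf_neq0 => t Tt; rewrite expf_neq0 // linp_neq0 // (lP t Tt).1.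
have hL c v : ev (c *: v) L = c ^+ (\sum_(t in T) k t) * ev v L.
  rewrite -prodrXr !rmorph_prod -big_split; apply: eq_bigr => t _ /=.
  by rewrite !rmorphXn /= (homog_ev _ _ (linp_homog _)) expr1 exprMn.
have hQ := homog_factor L0 JE hL (fun c v => det_jac_homog c v fd).
have Q_const : Q = (ev 0 Q)%:MP.
  have [le_s|lt_s] := leqP (\sum_i (d i).-1) (\sum_(t in T) k t).
    exact: homog_factor_const le_s hQ.
  have hQ' c v : c != 0 -> ev (c *: v) Q =
      c ^+ (\sum_i (d i).-1 - \sum_(t in T) k t) * ev v Q.
    move=> c0; apply: (mulfI (expf_neq0 (\sum_(t in T) k t) c0)).
    by rewrite hQ mulrA -exprD subnKC // ltnW.
  set s := (_ - _)%N in hQ'; have s0 : (0 < s)%N by rewrite subn_gt0.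
  exfalso.
  have lp0 t : t \in T -> (p0 *m l t) 0 0 != 0.
    move=> Tt; apply/eqP => e; have : t = 1%g.
      apply: fp0; first exact: (subsetP TG).
      by apply/((lP t Tt).2); apply/matrixP => i j; rewrite !ord1 e mxE.
    by move=> t1; have := rankT Tt; rewrite t1 repr_mx1 subrr mxrank0.
  (* [u *m M t] is a combination of [p0] and [u] lying on the hyperplane of [l t]. A zero of [Q] on
     that hyperplane of the form [u + c p0] is proportional to it, so [u] is chosen with [Q] nonzero
     at [u *m M t]. *)
  pose M t : 'M[C]_n := l t *m p0 - ((p0 *m l t) 0 0)%:M.
  have ME u t : u *m M t = (u *m l t) 0 0 *: p0 - (p0 *m l t) 0 0 *: u.
    rewrite mulmxBr mul_mx_scalar mulmxA [X in X *m p0]mx11_scalar.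
    by rewrite mul_scalar_mx.
  (* For these [x] the fixed space has codimension at least two, so adding [p0] leaves a proper
     subspace, which a generic [u] avoids. *)
  pose big x := (x \in G) && (1 < \rank (rG x - 1%:M)%R)%N.
  have /choice[q qP] x : exists q : 'cV[C]_n, big x ->
      q != 0 /\ (kermx (rG x - 1%:M) + p0)%MS *m q = 0.
    case bx: (big x); last by exists 0.
    have [|q q0 qX] := @proper_subspace_form _ _ _ (kermx (rG x - 1%:M) + p0)%MS.
      apply: leq_ltn_trans (mxrank_adds_leqif _ _) _.
      move: bx => /andP[_]; rewrite mxrank_ker.
      have := rank_leq_row p0; have := rank_leq_row (rG x - 1%:M); lia.
    by exists q.
  pose g (i : gT + gT) := match i with
    inl x => linp (q x) | inr t => act (M t) Q end.
  pose P (i : gT + gT) := match i with inl x => big x | inr t => t \in T end.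
  have [[x bx|t Tt]|u uP] := @generic_point _ _ _ P g.
  - exact: linp_neq0 (qP x bx).1.
  (* On the hyperplane of [l t] the matrix [M t] acts as a nonzero scalar, so a zero pullback would
     make [Q] vanish there and be divisible by [linp (l t)]. *)
  - apply/eqP => QM; apply: (kP t Tt); apply: linp_dvd; first exact: (lP t Tt).1.
    move=> v vl; have := congr1 (ev ((- ((p0 *m l t) 0 0)^-1) *: v)) QM.
    rewrite rmorph0 ev_act ME -scalemxAl vl scaler0 mxE scale0r add0r.
    by rewrite scalerA mulrN mulfV ?lp0 // scaleN1r opprK.
  have zero v : ev v Q = 0 -> exists x, [/\ x \in G, x != 1%g & v *m rG x = v].
    move=> Qv; apply: contrapT => H; have /J_free : free_at rG v.
      move=> x Gx vx; apply/eqP; apply: contraT => x1.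
      by case: H; exists x.
    by rewrite JE rmorphM /= Qv mul0r eqxx.
  have [[c Qc]|/zero[x [Gx x1 px]]] := plane_zero p0 u s0 hQ'; last first.
    by move/eqP: x1; apply; apply: fp0.
  have [x [Gx x1 vx]] := zero _ Qc.
  have rx := nontrivial_rank fG Gx x1.
  have [bx|nbx] := boolP (big x).
    have := uP (inl x) bx; rewrite /= ev_linp.
    have /submxP[a ->] : (u <= kermx (rG x - 1%:M) + p0)%MS.
      have -> : u = (u + c *: p0) + (- c) *: p0 by rewrite scaleNr addrK.
      apply: addmx_sub_adds; last exact: scalemx_sub.
      by rewrite sub_kermx mulmxBr mulmx1 vx subrr.
    by rewrite -mulmxA (qP x bx).2 mulmx0 mxE eqxx.
  have r1 : \rank (rG x - 1%:M) = 1%N.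
    by move: nbx; rewrite /big Gx /= -leqNgt => H; apply/eqP; rewrite eqn_leq H.
  have [t Tt tP] := reflection_hyperplanes Gx r1.
  have vl : (u + c *: p0) *m l t = 0 by apply/((lP t Tt).2)/tP.
  have := uP (inr t) Tt; rewrite /= ev_act ME.
  have -> : (u *m l t) 0 0 *: p0 - (p0 *m l t) 0 0 *: u =
     (- (p0 *m l t) 0 0) *: (u + c *: p0).
    have ul : (u *m l t) 0 0 = - (c * (p0 *m l t) 0 0).
      apply/eqP; rewrite -addr_eq0; apply/eqP.
      have := congr1 (fun A : 'M_1 => A 0 0) vl.
      by rewrite mulmxDl -scalemxAl !mxE.
    by rewrite ul scalerDr !scaleNr scalerA mulrC addrC.
  by rewrite hQ' ?oppr_eq0 ?lp0 // Qc mulr0 eqxx.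
have Jp : ev p J != 0.
  rewrite JE rmorphM /= mulf_neq0 //.
    rewrite Q_const evC; apply: contraNneq J0 => Q0.
    by rewrite JE Q_const Q0 mul0r.
  rewrite rmorph_prod /=; apply/prodf_neq0 => t Tt.
  rewrite rmorphXn expf_neq0 //= ev_linp; apply: contra (pT t Tt) => /eqP e.
  apply/eqP/((lP t Tt).2)/matrixP => i j; rewrite !ord1 e mxE //.
(* An [x] fixing [p] satisfies [jac_at f p = jac_at f p *m (rG x)^T], where the Jacobian is
   invertible. *)
move=> x Gx px; apply/eqP; rewrite -in_set1; apply: (subsetP fG); rewrite inE Gx mul1mx /=.
have := jac_at_repr p jf Gx; rewrite px => e; apply/eqP/trmx_inj.
rewrite trmx1; have uJ : jac_at f p \in unitmx.
  by rewrite unitmxE unitfE -ev_det_jac.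
by apply: (can_inj (mulKmx uJ)); rewrite mulmx1 -e.
Qed.

End Regular.

(** * Centralisers of regular elements *)

Section Springer.
Variables (C : numClosedFieldType) (gT : finGroupType) (G : {group gT}) (n : nat).
Variable rG : mx_representation C G n.
Variables (f : 'I_n -> {mpoly C[n]}) (d : 'I_n -> nat).
Variables (g : gT) (z : C) (A : 'rV[C]_n).
Hypothesis bf : basic_invariants rG f d.
Hypotheses (Gg : g \in G) (Ag : A *m rG g = z *: A).
Hypothesis fA : free_at rG A.

Let E := eigenspace (rG g) z.
Let rZ := subg_repr rG (subsetIl G 'C[g]%g).

Lemma eigenspace_cent1_module : mxmodule rZ E.
Proof.
apply/mxmoduleP => x /setIP[Gx /cent1P cx]; apply/eigenspaceP.
rewrite -mulmxA -[rZ x]/(rG x) -repr_mxM // cx repr_mxM // mulmxA.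
by have /eigenspaceP-> := submx_refl E; rewrite -scalemxAl.
Qed.

Variable modE : mxmodule rZ E.
Let rE := submod_repr modE.
Let B := row_base E.
Let A1 := in_submod E A.

Let A1B : A1 *m B = A.
Proof. by rewrite -[_ *m _]/(val_submod _) in_submodK //; apply/eigenspaceP. Qed.

Let BE m (w : 'M_(m, \rank E)) : w *m B *m rG g = z *: (w *m B).
Proof. by apply/eigenspaceP; exact: val_submodP. Qed.

Let BrE x : x \in 'C_G[g]%g -> rE x *m B = B *m rG x.
Proof.
move=> Zx; have := val_submodJ modE 1%:M Zx.
by rewrite mul1mx /val_submod /= mul1mx.
Qed.

Lemma free_eigenspace : free_at rE A1.
Proof.
move=> x Zx Ax; have /setIP[Gx _] := Zx; apply: fA => //.
by rewrite -{1}A1B -mulmxA -BrE // mulmxA Ax.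
Qed.

Lemma eigenspace_faithful : mx_faithful rE.
Proof.
apply/subsetP => x; rewrite inE mul1mx => /andP[Zx /eqP x1].
by rewrite inE (free_eigenspace Zx) // x1 mulmx1.
Qed.

Let S := [set i | z ^+ d i == 1].
Let res i := act B (f i).

(** On [E] the element [g] is multiplication by [z], so invariance reads [z ^+ d i * f i = f i]
    there. *)
Let res0 i : i \notin S -> res i = 0.
Proof.
have [jf fd _ _ _] := bf; rewrite inE => zi; apply: ev_eq0 => w; rewrite ev_act.
have := ev_repr (w *m B) (jf i) Gg; rewrite BE (homog_ev _ _ (fd i)) => /eqP.
rewrite -subr_eq0 -[X in _ - X]mul1r -mulrBl mulf_eq0 subr_eq0 (negPf zi).
by move/eqP.
Qed.

Let res_inv i : invp rE (res i).
Proof.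
have [jf _ _ _ _] := bf; move=> x Zx; have /setIP[Gx _] := Zx.
by rewrite -act_mulmx BrE // act_mulmx (jf i).
Qed.

Let jac_res : jac_at res A1 = jac_at f A *m B^T.
Proof.
apply/matrixP => i k; rewrite !mxE mderiv_act (raddf_sum (ev A1)).
by apply: eq_bigr => j _; rewrite /= !mxE evZ ev_act A1B mulrC.
Qed.

Let unit_jac : jac_at f A \in unitmx.
Proof. by rewrite unitmxE unitfE (basic_invariants_jac bf). Qed.

Let rank_res : \rank (jac_at res A1) = \rank E.
Proof.
rewrite jac_res -mxrank_tr trmx_mul trmxK mxrankMfree.
  by apply/eqP; exact: row_base_free.
by rewrite row_free_unit unitmx_tr.
Qed.

(** The gradients at [A] of the [f i] with [i] in [S] are independent eigenvectors of the transpose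
    of [g] for [z], which bounds [#|S|] above. Conversely the restrictions to [E] have a Jacobian of
    rank [\rank E] at [A1], and those outside [S] vanish. *)
Lemma card_degrees : #|S| = \rank E.
Proof.
have [jf fd d0 _ _] := bf; pose e := @enum_val _ (mem S).
have e_inj : injective e := enum_val_inj.
apply/eqP; rewrite eqn_leq; apply/andP; split.
  have RJ : \rank (rowsub e (jac_at f A)) = #|S|.
    rewrite -[jac_at f A]mul1mx -mul_rowsub_mx mxrankMfree ?row_free_unit //.
    apply/eqP; rewrite -[_ == _]/(row_free _); apply/row_freeP.
    exists (rowsub e 1%:M)^T; apply/matrixP => i j; rewrite !mxE.
    rewrite (bigD1 (e i)) //= big1 => [|k ki].
      by rewrite !mxE eqxx mul1r addr0 eq_sym (inj_eq e_inj).
    by rewrite !mxE eq_sym (negPf ki) mul0r.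
  have rT : \rank (kermx ((rG g)^T - z%:M)) = \rank E.
    by rewrite !mxrank_ker -(mxrank_tr (rG g - _)) linearB /= tr_scalar_mx.
  rewrite -RJ -rT; apply: mxrankS; apply/row_subP => i.
  rewrite row_rowsub sub_kermx mulmxBr mul_mx_scalar subr_eq0; apply/eqP.
  have Si : z ^+ d (e i) == 1 by have := enum_valP i; rewrite inE.
  have := congr1 (row (e i)) (jac_at_repr A jf Gg).
  rewrite Ag row_mul => H.
  have -> : row (e i) (jac_at f A) *m (rG g)^T =
     z *: (row (e i) (jac_at f (z *: A)) *m (rG g)^T).
    rewrite scalemxAl; congr (_ *m _); apply/rowP => k; rewrite !mxE.
    rewrite (homog_ev _ _ (homog_mderiv_pred k (fd _))) mulrA -exprS prednK //.
    by rewrite (eqP Si) mul1r.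
  by rewrite -H.
rewrite -rank_res.
have -> : jac_at res A1 = (rowsub e 1%:M)^T *m rowsub e (jac_at res A1).
  apply/matrixP => i k; rewrite [RHS]mxE; have [iS|iS] := boolP (i \in S).
    rewrite (bigD1 (enum_rank_in iS i)) //= big1 => [|j ji].
      by rewrite !mxE /e enum_rankK_in // eqxx mul1r addr0.
    rewrite !mxE; case: eqP => [ei|]; last by rewrite mul0r.
    by case/eqP: ji; apply: e_inj; rewrite /e enum_rankK_in.
  rewrite mxE res0 // mderiv0 rmorph0 big1 // => j _; rewrite !mxE.
  case: eqP => [ei|]; last by rewrite mul0r.
  by move: iS; rewrite -ei enum_valP.
exact: leq_trans (mxrankM_maxr _ _) (rank_leq_row _).
Qed.

Let e (k : 'I_(\rank E)) : 'I_n := enum_val (cast_ord (esym card_degrees) k).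
Let F k := res (e k).

Let e_onto i : i \in S -> exists k, i = e k.
Proof.
move=> iS; exists (cast_ord card_degrees (enum_rank_in iS i)).
by rewrite /e cast_ordK enum_rankK_in.
Qed.

Let det_jac_F : \det (jac_at F A1) != 0.
Proof.
rewrite -unitfE -unitmxE -row_full_unit -sub1mx.
have : row_full (jac_at res A1).
  by rewrite /row_full rank_res.
rewrite -sub1mx => /submx_trans; apply; apply/row_subP => i.
have [/e_onto[k ->]|iS] := boolP (i \in S).
  have -> : row (e k) (jac_at res A1) = row k (jac_at F A1).
    by apply/rowP => j; rewrite !mxE.
  exact: row_sub.
suff -> : row i (jac_at res A1) = 0 by rewrite sub0mx.
by apply/rowP => j; rewrite !mxE res0 // mderiv0 rmorph0.
Qed.

Let aF : alg_indep F := alg_indep_jac_at det_jac_F.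

Let res_gen p : invp rG p -> exists U, act B p = pcomp F U.
Proof.
have [_ _ _ gf _] := bf => /gf[P ->].
have /choice[U UE] i : exists U, res i = pcomp F U.
  have [/e_onto[k ->]|/res0->] := boolP (i \in S).
    by exists 'X_k; rewrite pcompX.
  by exists 0; rewrite rmorph0.
exists (pcomp U P); rewrite act.unlock !pcomp_pcomp; apply: eq_pcomp => i.
by rewrite -UE /res act.unlock.
Qed.

(* Averaging a polynomial that separates A from its other translates and from
   the other translates of E. *)
Let conductor : exists2 D, ev A1 D != 0 &
  forall u, invp rE u -> exists U, u * D = pcomp F U.
Proof.
(* If [A] lay in the translate of [E] by [x], then [x^-1 * g] and [g * x^-1] would send [A] to the
   same vector, and freeness would make [x] commute with [g]. *)
have notE x : x \in G -> x \notin 'C_G[g]%g -> ~~ (A <= B *m rG x)%MS.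
  move=> Gx; apply: contra => /submxP[w AE]; rewrite inE Gx; apply/cent1P.
  have Bg : w *m B *m rG g = z *: (w *m B) := BE w.
  have Axw : A *m rG x^-1%g = w *m B by rewrite AE mulmxA repr_mxK.
  have Axg : A *m rG (x^-1 * g)%g = A *m rG (g * x^-1)%g.
    rewrite !repr_mxM ?groupV // !mulmxA Axw Bg Ag -scalemxAl Axw //.
  have : A *m rG (x^-1 * g * (g * x^-1)^-1)%g = A.
    by rewrite repr_mxM ?groupV ?groupM ?groupV // mulmxA Axg repr_mxK // groupM ?groupV.
  move/fA; rewrite !groupM ?groupV ?groupM ?groupV // => /(_ isT) /eqP.
  rewrite -eq_mulgV1 => /eqP H.
  by apply: (mulgI x^-1%g); rewrite mulKg mulgA H mulgKV.
have /choice[l lP] x : exists l : 'cV[C]_n, (x \in G) && (x \notin 'C_G[g]%g) ->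
    (A *m l) 0 0 != 0 /\ B *m rG x *m l = 0.
  case: andP => [[Gx nZx]|]; last by exists 0.
  by have [l ? ?] := notin_subspace (notE x Gx nZx); exists l.
have [|q qA qs] := @separating_poly _ _ A
    [seq A *m rG x | x in [pred x | (x \in G) && (x != 1%g)]].
  apply/imageP => -[x /andP[Gx x1] AE]; case/eqP: x1; exact: fA.
pose chi := q * \prod_(x in G | x \notin 'C_G[g]%g) linp (l x).
have chiA : ev A chi != 0.
  rewrite rmorphM /= qA mul1r rmorph_prod /=; apply/prodf_neq0 => x Px.
  by rewrite ev_linp (lP x Px).1.
pose D := \sum_(x in 'C_G[g]%g) act (B *m rG x) chi.
exists D.
  rewrite rmorph_sum (bigD1 1%g) ?group1 //= big1 => [|x /andP[/setIP[Gx _] x1]].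
    by rewrite addr0 repr_mx1 mulmx1 ev_act A1B.
  rewrite ev_act mulmxA A1B rmorphM /= (qs _ _).1 ?mul0r //.
  by apply/imageP; exists x; rewrite // inE Gx.
(* [act (pinvmx B) u] extends [u] from [E] to the whole space. Restricted to [E], the terms of [W]
   outside the centraliser vanish, and the others add up to [u * D]. *)
move=> u ju; pose W := \sum_(x in G) act (rG x) (chi * act (pinvmx B) u).
have BB : B *m pinvmx B = 1%:M by rewrite mulmxVp // row_base_free.
have [U UE] := res_gen (sum_act_inv rG (chi * act (pinvmx B) u)).
exists U; rewrite -UE raddf_sum (bigID (mem 'C_G[g]%g)) /=.
rewrite [X in _ + X]big1 => [|x Px]; last first.
  have Gx : x \in G by case/andP: Px.
  rewrite -act_mulmx !rmorphM /= rmorph_prod /= (bigD1 x) //=.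
  suff -> : act (B *m rG x) (linp (l x)) = 0 by rewrite mul0r mulr0 mul0r.
  by apply: ev_eq0 => w; rewrite ev_act ev_linp -mulmxA (lP x Px).2 mulmx0 mxE.
rewrite addr0 /D mulr_sumr; apply: eq_big => [x|x Zx].
  by rewrite andb_idl // => /setIP[].
rewrite -act_mulmx [RHS]rmorphM /= mulrC; congr (_ * _).
by rewrite -act_mulmx -BrE // -mulmxA BB mulmx1 (ju x).
Qed.

Lemma eigenspace_generates : generates rE F.
Proof.
move=> u ju; have [D DA cD] := conductor.
have D0 : D != 0 by apply: contraNneq DA => ->; rewrite rmorph0.
have [P PE] : exists P, D = pcomp F P.
  by have [P] := cD 1 (invpC rE 1); rewrite mul1r; exists P.
have /choice[N NE] k : exists N, u ^+ k * D = pcomp F N.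
  apply: cD; elim: k => [|k IH]; first exact: (invpC rE 1).
  by rewrite exprS; apply: invpM.
have P0 : P != 0 by apply: contraNneq D0 => P0; rewrite PE P0 rmorph0.
(* The division takes place in the polynomial ring on the [F k]: the identity
   [(u D)^(k+1) = D^k (u^(k+1) D)] lifts to it by algebraic independence. *)
have [k|Q QE] := mdvd_powers (N := N 1%N) P0.
  exists (N k.+1); apply/eqP; rewrite -subr_eq0; apply/eqP/aF.
  rewrite rmorphB rmorphM !rmorphXn /= -!NE -PE expr1 exprMn [D ^+ k.+1]exprSr.
  by apply/eqP; rewrite subr_eq0; apply/eqP; ring.
exists Q; apply: (mulIf D0); have := NE 1%N; rewrite expr1 => ->.
by rewrite QE rmorphM /= -PE.
Qed.

Theorem eigenspace_reflection_group : <<reflections rE>>%g = 'C_G[g]%g.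
Proof.
have [_ fd d0 _ _] := bf.
apply: (generated_by_reflections (F := F) (dF := d \o e) eigenspace_faithful).
split=> [i|i|i||]; [exact: res_inv | exact/act_homog/fd | exact: d0 |
  exact: eigenspace_generates | exact: aF].
Qed.

End Springer.

(** * Relative Weyl groups *)

(** The rows of [K] span the hyperplane of [l] and satisfy a nontrivial relation [c]. Its conjugate
    kills the Gram matrix [N], so [N] is singular, and a left kernel vector is orthogonal to the
    hyperplane. *)
Lemma dot_orthogonal (C : numClosedFieldType) n r (h : {dot 'rV[C]_n for Num.conj})
    (B : 'M[C]_(r, n)) (l : 'cV[C]_r) : l != 0 ->
  exists2 o : 'rV_r, o != 0 & forall u : 'rV_r, u *m l = 0 -> h (o *m B) (u *m B) = 0.
Proof.
move=> l0; set K := kermx l.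
have rl : (0 < \rank l)%N by rewrite lt0n mxrank_eq0.
have [c cK c0] : exists2 c : 'rV_r, c *m K = 0 & c != 0.
  have : kermx K != 0.
    rewrite -mxrank_eq0 !mxrank_ker; have := rank_leq_row l; lia.
  by case/rowV0Pn => c /sub_kermxP cK c0; exists c.
pose N : 'M[C]_r := \matrix_(k, j) h (row k B) (row j K *m B).
have oN (o : 'rV_r) j : (o *m N) 0 j = h (o *m B) (row j K *m B).
  rewrite [o *m B]mulmx_sum_row linear_sumlz mxE.
  by apply: eq_bigr => k _; rewrite linearZl_LR mxE.
have Nc : N *m (map_mx Num.conj c)^T = 0.
  apply/colP => k; have E : h (row k B) ((\sum_j c 0 j *: row j K) *m B) = 0.
    by rewrite -mulmx_sum_row cK mul0mx linear0r.
  rewrite !mxE -[RHS]E mulmx_suml linear_sumr.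
  by apply: eq_bigr => j _; rewrite -scalemxAl linearZr_LR !mxE mulrC.
have : \det N == 0.
  apply: contraNT c0; rewrite -unitfE -unitmxE => uN.
  have /(congr1 trmx) : (map_mx Num.conj c)^T = 0 by rewrite -(mulKmx uN (_^T)) Nc mulmx0.
  rewrite trmxK trmx0 => /rowP c0; apply/eqP/rowP => i.
  by have := c0 i; rewrite !mxE => /eqP; rewrite conjC_eq0 => /eqP.
case/det0P => o o0 oN0; exists o => // u /sub_kermxP/submxP[a ->].
rewrite (mulmx_sum_row a) mulmx_suml linear_sumr big1 // => j _.
by rewrite -scalemxAl linearZr_LR /= -oN oN0 mxE mulr0.
Qed.

(** * The relative Weyl group on the Levi space of an eigenvector *)

Section WeylRoots.
Variables (C : numClosedFieldType) (n N : nat) (D : rootDatum n N).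
Variables (gT : finGroupType) (W : {group gT}) (rW : mx_representation C W n).
Hypothesis hW : is_weyl_group D rW.

(** [rW w *m root_form C D i] is the form [alpha_i] composed with [w]. The elements with this
    property form a subgroup, which contains the generating reflections by [rd_root_refl]. *)
Lemma weyl_permutes_roots w i : w \in W ->
  exists j, rW w *m root_form C D i = root_form C D j.
Proof.
pose H := [set w in W | [forall i, exists j, rW w *m root_form C D i == root_form C D j]].
suff : w \in W -> w \in H.
  move=> HW /HW; rewrite inE => /andP[_ /forallP/(_ i)/existsP[j /eqP]].
  by exists j.
have gH : group_set H.
  apply/group_setP; split.
    by rewrite inE group1; apply/forallP => k; apply/existsP; exists k; rewrite repr_mx1 mul1mx.
  move=> x y; rewrite !inE => /andP[Wx /forallP Hx] /andP[Wy /forallP Hy].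
  rewrite groupM //; apply/forallP => k.
  have /existsP[j /eqP yj] := Hy k; have /existsP[m /eqP xm] := Hx j.
  by apply/existsP; exists m; rewrite repr_mxM // -mulmxA yj xm.
apply: (subsetP (_ : W \subset Group gH)).
rewrite -{1}(weyl_generated hW) gen_subG; apply/subsetP => x.
rewrite !inE => /andP[Wx /existsP[k /eqP xk]]; rewrite Wx.
apply/forallP => m; have [j jE] := rd_root_refl D k m.
apply/existsP; exists j; apply/eqP; rewrite xk /root_reflection.
rewrite mulmxBl mul1mx -mulmxA /root_form /coroot_vec jE.
by rewrite map_mxB !map_mxM.
Qed.

Lemma levi_spaceP (phi : {set 'I_N}) m (M : 'M[C]_(m, n)) :
  reflect (forall i, i \in phi -> M *m root_form C D i = 0)
          (M <= levi_space C D phi)%MS.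
Proof.
apply: (iffP sub_bigcapmxP) => H i iphi; apply/sub_kermxP; exact: H.
Qed.

Variables (h : {dot 'rV[C]_n for Num.conj}).
Hypothesis hinv : W_invariant rW h.
Variables (g : gT) (z : C) (A : 'rV[C]_n).
Hypotheses (Wg : g \in W) (Ag : A *m rW g = z *: A).
Let phi := levi_annihilator D A.
Let U := levi_space C D phi.
Let G := levi_weyl_group D rW phi.
Let rU := levi_weyl_repr D rW phi.
Let r := \rank U.

Let inphi i : (i \in phi) = (A *m root_form C D i == 0).
Proof. by rewrite inE. Qed.

Lemma levi_space_vector : (A <= U)%MS.
Proof. by apply/levi_spaceP => i; rewrite inphi => /eqP. Qed.

Let A1 : 'rV_r := in_submod U A.
Let A1E : val_submod A1 = A.
Proof. exact: in_submodK levi_space_vector. Qed.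

(** A root vanishing at [A] composed with [g] is a root that still vanishes at [A], because [g] only
    rescales [A]. *)
Lemma weyl_eigenvector_normalizes : g \in rstabs rW U.
Proof.
rewrite inE Wg; apply/levi_spaceP => i iphi; have [j jE] := weyl_permutes_roots i Wg.
rewrite -mulmxA jE; apply: (levi_spaceP _ _ (submx_refl U)).
by rewrite inphi -jE mulmxA Ag -scalemxAl (eqP (_ : A *m _ == 0)) ?scaler0 // -inphi.
Qed.

Lemma levi_repr_val w m (v : 'M_(m, r)) : w \in rstabs rW U ->
  val_submod (v *m rU (coset (rstab rW U) w)) = val_submod v *m rW w.
Proof.
move=> Nw; rewrite /rU /levi_weyl_repr /rel_weyl_repr quo_repr_coset //.
by rewrite /rstabs_repr val_submodJ.
Qed.

Lemma levi_coset x : x \in G -> exists2 w, w \in rstabs rW U & x = coset (rstab rW U) w.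
Proof. by case/morphimP => w _ Nw ->; exists w. Qed.

Lemma levi_faithful : mx_faithful rU.
Proof.
apply/subsetP => x; rewrite inE mul1mx => /andP[/levi_coset[w Nw ->] /eqP w1].
rewrite inE; apply/eqP/coset_id; have /setIdP[Ww _] := Nw.
rewrite inE Ww; have := levi_repr_val 1%:M Nw; rewrite w1 mulmx1 => H.
have /submxP[a UE] : (U <= val_submod (1%:M : 'M_r))%MS by rewrite val_submod1.
suff UwE : U *m rW w = U by apply/eqP.
by rewrite [in LHS]UE -mulmxA -H -UE.
Qed.

Let T := [set x in G | `[< exists2 i, i \notin phi & is_sigma h i (rU x) >]].
Let lam i : 'cV_r := row_base U *m root_form C D i.

Let lamE i m (v : 'M_(m, r)) : val_submod v *m root_form C D i = v *m lam i.
Proof. by rewrite /lam mulmxA. Qed.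

Let A1lam i : i \notin phi -> A1 *m lam i != 0.
Proof. by rewrite -lamE A1E inphi. Qed.

Let lam0 i : i \notin phi -> lam i != 0.
Proof. by move/A1lam; apply: contraNneq => ->; rewrite mulmx0. Qed.

(** An orthogonal vector on the hyperplane itself would be isotropic, which positivity of [h]
    excludes; it can therefore be normalised. *)
Let orth i : i \notin phi -> exists2 o : 'rV_r, o *m lam i = 1%:M &
  forall u : 'rV_r, u *m lam i = 0 -> h (val_submod o) (val_submod u) = 0.
Proof.
move=> iphi; have [o o0 oP] := dot_orthogonal h (row_base U) (lam0 iphi).
have ol : (o *m lam i) 0 0 != 0.
  apply: contraNneq o0 => e; have /oP : o *m lam i = 0.
    by apply/matrixP => x y; rewrite !ord1 e mxE.
  move=> hoo; apply: contraT => o0; have : o *m row_base U != 0.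
    apply: contraNneq o0 => e'; apply/eqP.
    by apply: (row_free_inj (row_base_free U)); rewrite e' mul0mx.
  by move/(neq0_dnorm_gt0 (s := h)); rewrite hoo ltxx.
exists (((o *m lam i) 0 0)^-1 *: o).
  rewrite -scalemxAl [X in _ *: X]mx11_scalar scale_scalar_mx mulVf //.
move=> u /oP ou; rewrite /val_submod /= -scalemxAl linearZl_LR /=.
by rewrite [h _ _]ou mulr0.
Qed.

(** The hyperplane and [o] span the space, so [is_sigma] determines [f]: it is
    [v |-> v - 2 lam_i(v) o]. *)
Let sigmaE i o f : i \notin phi -> o *m lam i = 1%:M ->
    (forall u : 'rV_r, u *m lam i = 0 -> h (val_submod o) (val_submod u) = 0) ->
  is_sigma h i f -> f = 1%:M + lam i *m (- 2 *: o).
Proof.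
move=> iphi ol oP [f1 f2]; apply/row_matrixP => k; rewrite !rowE.
set v := delta_mx 0 k; pose c := (v *m lam i) 0 0.
have vE : v = (v - c *: o) + c *: o by rewrite subrK.
have cE : v *m lam i = c%:M by rewrite [LHS]mx11_scalar.
have of_ : o *m f = - o.
  by apply: f2 => u; rewrite lamE; apply: oP.
rewrite [in LHS]vE mulmxDl f1 => [|]; last first.
  rewrite lamE mulmxBl cE -scalemxAl ol scale_scalar_mx mulr1 subrr //.
rewrite -scalemxAl of_ mulmxDr mulmx1 mulmxA cE mul_scalar_mx scalerA.
by rewrite scalerN -addrA -opprD -scalerDl mulrN scaleNr mulr_natr mulr2n.
Qed.

Let T_sigma t : t \in T -> exists i o, [/\ i \notin phi, o *m lam i = 1%:M,
  (forall u : 'rV_r, u *m lam i = 0 -> h (val_submod o) (val_submod u) = 0),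
  is_sigma h i (rU t) & rU t = 1%:M + lam i *m (- 2 *: o)].
Proof.
rewrite inE => /andP[Gt /asboolP[i iphi si]]; have [o ol oP] := orth iphi.
by exists i, o; split=> //; apply: sigmaE si.
Qed.

Let fix_lam i (o : 'rV_r) (v : 'rV_r) : o *m lam i = 1%:M ->
  v *m (1%:M + lam i *m (- 2 *: o)) = v -> v *m lam i = 0.
Proof.
move=> ol; rewrite mulmxDr mulmx1 => /eqP; rewrite -subr_eq0 addrC addKr mulmxA.
move=> /eqP/(congr1 (mulmx^~ (lam i))) /=; rewrite mul0mx -mulmxA -scalemxAl ol.
rewrite scalemx1 mul_mx_scalar => /eqP; rewrite scaler_eq0 oppr_eq0 pnatr_eq0 /=.
by move/eqP.
Qed.

Let rankT t : t \in T -> \rank (rU t - 1%:M) = 1%N.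
Proof.
case/T_sigma => i [o [iphi ol _ _ ->]]; rewrite addrC addKr.
apply/eqP; rewrite eqn_leq; apply/andP; split.
  exact: leq_trans (mxrankM_maxl _ _) (rank_leq_col _).
rewrite lt0n mxrank_eq0; apply: contraNneq (lam0 iphi) => e.
have := congr1 (mulmx^~ (lam i)) e; rewrite /= mul0mx -mulmxA -scalemxAl ol.
by rewrite scalemx1 mul_mx_scalar => /eqP; rewrite scaler_eq0 oppr_eq0 pnatr_eq0 /=.
Qed.

(** The choice of [phi] enters here: a root outside [phi] does not vanish at [A], so no reflecting
    hyperplane contains [A1]. *)
Let regT t : t \in T -> A1 *m rU t != A1.
Proof.
case/T_sigma => i [o [iphi ol _ _ ->]]; apply: contraNneq (A1lam iphi) => e.
by rewrite (fix_lam ol e).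
Qed.

(** An orthogonal reflection is determined by its hyperplane, and the action is faithful. *)
Let sepT t t' : t \in T -> t' \in T ->
  (forall v : 'rV_r, v *m rU t = v -> v *m rU t' = v) -> t = t'.
Proof.
move=> Tt Tt' tt'; have Gt : t \in G by move: Tt; rewrite inE => /andP[].
have Gt' : t' \in G by move: Tt'; rewrite inE => /andP[].
have [i [o [iphi ol oP _ tE]]] := T_sigma Tt.
have [i' [o' [iphi' ol' _ [s1 s2] tE']]] := T_sigma Tt'.
have [a aE] : exists a, lam i' = a *: lam i.
  apply: forms_proportional => [|v vl]; first exact: lam0.
  apply: (fix_lam ol'); rewrite -tE'; apply: tt'.
  by rewrite tE mulmxDr mulmx1 mulmxA vl mul0mx addr0.
have a0 : a != 0.
  by apply: contraNneq (lam0 iphi') => a0; rewrite aE a0 scale0r.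
have lamK (v : 'rV_r) : val_submod v *m root_form C D i = 0 <->
    val_submod v *m root_form C D i' = 0.
  rewrite !lamE aE -scalemxAr; split=> [->|/eqP]; first by rewrite scaler0.
  by rewrite scaler_eq0 (negPf a0) => /eqP.
have eqU : rU t = rU t'.
  rewrite tE; apply/esym/(sigmaE iphi ol oP); split=> [v /lamK/s1 //|v vK].
  by apply: s2 => u /lamK; apply: vK.
exact: (mx_faithful_inj levi_faithful).
Qed.

(** Conjugating by [y] replaces the root by its composite with the inverse of a lift [w] of [y]. It
    stays outside [phi] because [w] preserves the Levi space, and orthogonality is kept by
    invariance of [h]. *)
Let normT : G \subset 'N(T)%g.
Proof.
apply/subsetP => y Gy; rewrite inE; apply/subsetP => _ /imsetP[x Tx ->].
have Gx : x \in G by move: Tx; rewrite inE => /andP[].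
have [i [o [iphi _ _ [s1 s2] _]]] := T_sigma Tx.
have [w Nw yE] := levi_coset Gy; have Ww : w \in W by case/setIdP: Nw.
have Nw' : w^-1%g \in rstabs rW U by rewrite groupV.
have y'E : (y^-1)%g = coset (rstab rW U) w^-1%g.
  by rewrite yE morphV // (subsetP (rstabs_norm_rstab rW U)).
have [j jE] : exists j, rW w^-1%g *m root_form C D i = root_form C D j.
  by apply: weyl_permutes_roots; rewrite groupV.
have iE : root_form C D i = rW w *m root_form C D j.
  by rewrite -jE mulmxA -repr_mxM ?groupV // mulgV repr_mx1 mul1mx.
rewrite inE groupJ //; apply/asboolP; exists j.
  apply: contra iphi => jphi; rewrite inphi iE mulmxA; apply/eqP.
  apply: (levi_spaceP _ _ _ j jphi).
  apply: submx_trans (submxMr _ levi_space_vector) _.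
  by case/setIdP: Nw.
have fE (v : 'rV_r) : v *m rU (x ^ y)%g = v *m rU y^-1%g *m rU x *m rU y.
  by rewrite conjgE !repr_mxM ?groupM ?groupV // !mulmxA.
have vK (v : 'rV_r) : val_submod (v *m rU y^-1%g) *m root_form C D i =
    val_submod v *m root_form C D j.
  by rewrite y'E levi_repr_val // -mulmxA jE.
split=> v vP; rewrite fE.
  rewrite s1; last by rewrite vK.
  by rewrite -mulmxA -repr_mxM ?groupV // mulVg repr_mx1 mulmx1.
rewrite s2 => [|u uK].
  by rewrite mulNmx -mulmxA -repr_mxM ?groupV // mulVg repr_mx1 mulmx1.
rewrite -(hinv Ww) -!levi_repr_val // -yE -mulmxA -repr_mxM ?groupV // mulVg.
rewrite repr_mx1 mulmx1; apply: vP.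
by rewrite -vK (repr_mxK rU Gy).
Qed.

Hypothesis htwist : howlett_twist D rW h phi = 1%g.

Let genT : <<T>>%g = G.
Proof.
apply/eqP; rewrite eqEsubset gen_subG; apply/andP; split.
  by apply/subsetP => x; rewrite inE => /andP[].
by rewrite -quotient_sub1 ?norms_gen // -[(_ / _)%g]/(howlett_twist D rW h phi) htwist.
Qed.

Let gphi := coset (rstab rW U) g.

Let Ggphi : gphi \in G.
Proof. by apply: mem_quotient; exact: weyl_eigenvector_normalizes. Qed.

Let A1g : A1 *m rU gphi = z *: A1.
Proof.
apply: (row_free_inj (row_base_free U)).
rewrite -[LHS]/(val_submod _) levi_repr_val ?weyl_eigenvector_normalizes //.
by rewrite A1E Ag -scalemxAl -[_ *m row_base U]/(val_submod A1) A1E.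
Qed.

Let free_A1 : free_at rU A1.
Proof. exact: (regular_free levi_faithful genT normT rankT sepT regT). Qed.

Let rZ := subg_repr rU (subsetIl G 'C[gphi]%g).

Theorem levi_eigenspace_reflection_group :
  exists modE : mxmodule rZ (eigenspace (rU gphi) z),
    mx_faithful (submod_repr modE) /\
    is_reflection_group_repr (submod_repr modE).
Proof.
have reflT t : t \in T -> rank1_update (rU t).
  move=> Tt; apply: reflections_rank1; rewrite reflectionsP rankT // eqxx andbT.
  by move: Tt; rewrite inE => /andP[].
have [f [d bf]] := chevalley_basic_invariants levi_faithful genT reflT.
exists (eigenspace_cent1_module rU z Ggphi); split.
  exact: (eigenspace_faithful A1g free_A1).
exact: (eigenspace_reflection_group bf Ggphi A1g free_A1).
Qed.

End WeylRoots.

Theorem theorem8p4p1 (R : realType) (n N : nat) (D : rootDatum n N)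
  (gT : finGroupType) (W : {group gT}) (rW : mx_representation R[i] W n)
  (hW : is_weyl_group D rW)
  (h : {dot 'rV[R[i]]_n for Num.conj}) (hinv : W_invariant rW h)
  (r : nat) (hr : (1 <= r)%N) (g : gT) (hg : g \in W)
  (A : 'rV[R[i]]_n) (hA0 : A != 0)
  (hA : (A <= eigenspace (rW g) (zeta R r))%MS)
  (phi : {set 'I_N}) (hphi : phi = levi_annihilator D A)
  (htwist : howlett_twist D rW h phi = 1%g) :
  let gphi := coset (rstab rW (levi_space R[i] D phi)) g in
  let Z := ('C_(levi_weyl D rW phi)[gphi])%G in
  let rZ := subg_repr (levi_weyl_repr D rW phi) (subsetIl _ _ : Z \subset _) in
  exists modE : mxmodule rZ
      (eigenspace (levi_weyl_repr D rW phi gphi) (zeta R r)),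
    mx_faithful (submod_repr modE) /\
    is_reflection_group_repr (submod_repr modE).
Proof.
subst phi; move/eigenspaceP: hA => hA.
exact: (levi_eigenspace_reflection_group hW hinv hg hA htwist).
Qed.
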